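(* Let $k$ be a real number with $0<k^2<1$. If the series below converges, then $$\sum_{n=0}^{\infty} \frac{(-1)^n (2n+1)^2}{e^{(2n+1)\frac{K'}{K}\pi}-1} = \frac14+\frac{2(k^2-1)K^3}{\pi^3}.$$
   Context: For the elliptic modulus $k$ (with $0<k^2<1$), write $k'=\sqrt{1-k^2}$. The complete elliptic integral of the first kind is $K=K(k)=\int_0^{\pi/2}\frac{d\theta}{\sqrt{1-k^2\sin^2\theta}}$, and $K'=K(k')$. *)

(* Defs.v *)
(* Stdlib reals with Coquelicot. *)
From Stdlib Require Import Reals.
From Coquelicot Require Import Coquelicot.
Open Scope R_scope.

Definition compl_modulus (k : R) : R := sqrt (1 - k ^ 2).

(* The argument is the modulus k, not the parameter m = k ^ 2. *)
Definition ellipticK (k : R) : R :=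
  RInt (fun theta : R => 1 / sqrt (1 - k ^ 2 * (sin theta) ^ 2)) 0 (PI / 2).

Definition ellipticK' (k : R) : R := ellipticK (compl_modulus k).

(* Main.v *)
Require Import Defs.
From Stdlib Require Import Reals Lra Lia ZArith.
From Coquelicot Require Import Coquelicot.
Open Scope R_scope.

(** Fix [t > 0] and let [g (x)] be the sum of [sech (x + m t)] over all integers [m];
    up to scaling it is the Jacobi function [dn]. Put [a = g (0)], [b = g (t / 2)]
    ([period_sum], [half_period_sum]) and [c = sqrt (a ^ 2 - b ^ 2)]
    ([complementary_sum]). The theorem follows from three facts, where
    [J (a, b)] is the integral of [1 / sqrt (a^2 cos^2 + b^2 sin^2)] over
    [[0, PI / 2]]:

    - [a (a^2 - b^2) = 1 - 4 S], where [S] is the series of the theorem at the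
      nome [exp (- t)] ([sech_cube_sum], [lambert_series]);
    - [J (a, c) = PI / 2] ([gauss_integral_complementary]);
    - [J (a, b) = t / 2] ([gauss_integral_half_period]).

    Indeed, for the modulus [l = b / a], homogeneity of [J] turns the last two into
    [K (l) = a PI / 2] and [K' (l) = a t / 2]. Taking [t = PI K' (k) / K (k)], the
    moduli [k] and [l] have the same ratio [K' / K]; this ratio is a strictly
    decreasing function of the squared modulus, so [k^2 = l^2], and
    [1 - 4 S = a^3 (1 - k^2) = (2 K / PI)^3 (1 - k^2)].

    The relations among the sums are obtained by multiplying sums over the
    integers and regrouping the double sum by the difference of the indices
    ([zsum_mult_diagonals]). Since
    [sech x sech y = (tanh y - tanh x) / sinh (y - x)],
    the regrouped sums telescope. In this way [g (x) g (x + t / 2)] is constant,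
    which gives [a (t) = a (2 t) + b (2 t)] and [b (t)^2 = 4 a (2 t) b (2 t)]; likewise
    [a^2 - b^2] is a difference of sums of [sech^2], and the sum of [sech^3] is
    expressed by the previous ones. The latter combines with [a] to the sum of
    [sech''] over the progression, whose expansion in exponentials is the Lambert
    series.

    The two integrals come from the invariance of [J] under the
    arithmetic-geometric mean step ([gauss_integral_agm]). By the duplication
    relations, passing from [t] to [2 t] is such a step for [(a, c)] and tends to
    [(1, 1)], while passing from [t] to [t / 2] is, up to a factor 2, such a step
    for [(a, b)], where both sums are asymptotic to [PI / t] as [t] tends to 0. *)

(** * Absolutely convergent series and their double sums *)

Lemma ex_series_le_abs (u v : nat -> R) :
  (forall n, Rabs (u n) <= v n) -> ex_series v -> ex_series u.
Proof. intros H Hv. exact (ex_series_le u v H Hv). Qed.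

Lemma ex_series_comb (c d : R) (u v : nat -> R) :
  ex_series u -> ex_series v -> ex_series (fun n => c * u n + d * v n).
Proof.
  intros Hu Hv.
  exact (ex_series_plus _ _ (ex_series_scal_l c u Hu) (ex_series_scal_l d v Hv)).
Qed.

Lemma Series_comb (c d : R) (u v : nat -> R) :
  ex_series u -> ex_series v ->
  Series (fun n => c * u n + d * v n) = c * Series u + d * Series v.
Proof.
  intros Hu Hv. rewrite Series_plus.
  - now rewrite !Series_scal_l.
  - exact (ex_series_scal_l c u Hu).
  - exact (ex_series_scal_l d v Hv).
Qed.

Lemma Series_nonneg (u : nat -> R) :
  (forall n, 0 <= u n) -> ex_series u -> 0 <= Series u.
Proof.
  intros H0 Hu.
  replace 0 with (Series (fun _ : nat => 0 * 0)).
  - apply Series_le; [|exact Hu]. intros n. rewrite Rmult_0_l. split; [lra|apply H0].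
  - rewrite Series_scal_l. ring.
Qed.

Lemma partial_sum_le_Series (u : nat -> R) (N : nat) :
  (forall n, 0 <= u n) -> ex_series u -> sum_n u N <= Series u.
Proof.
  intros H0 Hu.
  rewrite (Series_incr_n u (S N)) by (auto with arith).
  simpl pred. rewrite <- sum_n_Reals.
  enough (0 <= Series (fun k => u (S N + k)%nat)) by lra.
  apply Series_nonneg; [intros; apply H0|].
  now apply ex_series_incr_n.
Qed.

Lemma term_le_Series (u : nat -> R) (n : nat) :
  (forall n, 0 <= u n) -> ex_series u -> u n <= Series u.
Proof.
  intros H0 Hu.
  apply Rle_trans with (2 := partial_sum_le_Series u n H0 Hu).
  destruct n as [|n]; [rewrite sum_O; lra|].
  rewrite sum_Sn. unfold plus; simpl.
  enough (0 <= sum_n u n) by lra.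
  clear Hu. induction n as [|n IH]; [rewrite sum_O; apply H0|].
  rewrite sum_Sn. unfold plus; simpl. specialize (H0 (S n)). lra.
Qed.

Lemma bounded_partial_sums (u : nat -> R) (M : R) :
  (forall n, 0 <= u n) -> (forall N, sum_n u N <= M) ->
  ex_series u /\ Series u <= M.
Proof.
  intros H0 HM.
  assert (Hex : ex_finite_lim_seq (sum_n u)).
  { apply ex_finite_lim_seq_incr with M; [|exact HM].
    intros n. rewrite sum_Sn. unfold plus; simpl. specialize (H0 (S n)). lra. }
  assert (Hs : ex_series u) by exact Hex.
  split; [exact Hs|].
  apply Series_correct in Hs.
  apply (is_lim_seq_le (sum_n u) (fun _ => M) (Series u) M HM Hs).
  apply is_lim_seq_const.
Qed.

Lemma Series_sum_n (F : nat -> nat -> R) (N : nat) :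
  (forall n, ex_series (fun m => F m n)) ->
  ex_series (fun m => sum_n (F m) N) /\
  Series (fun m => sum_n (F m) N) = sum_n (fun n => Series (fun m => F m n)) N.
Proof.
  intros HF. induction N as [|N [IH1 IH2]].
  - split.
    + apply (ex_series_ext (fun m => F m 0%nat)); [|apply HF].
      intros m. now rewrite sum_O.
    + rewrite sum_O. apply Series_ext. intros m. now rewrite sum_O.
  - split.
    + apply (ex_series_ext (fun m => plus (sum_n (F m) N) (F m (S N)))).
      * intros m. now rewrite sum_Sn.
      * exact (ex_series_plus (fun m => sum_n (F m) N) (fun m => F m (S N)) IH1 (HF _)).
    + rewrite sum_Sn, <- IH2. unfold plus; simpl.
      rewrite <- Series_plus by auto.
      apply Series_ext. intros m. now rewrite sum_Sn.
Qed.

(** Partial sums of the column sums are sums of partial row sums, hence bounded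
    by the iterated sum. *)
Lemma tonelli_le (F : nat -> nat -> R) :
  (forall m n, 0 <= F m n) ->
  (forall m, ex_series (F m)) -> ex_series (fun m => Series (F m)) ->
  (forall n, ex_series (fun m => F m n)) /\
  ex_series (fun n => Series (fun m => F m n)) /\
  Series (fun n => Series (fun m => F m n)) <= Series (fun m => Series (F m)).
Proof.
  intros H0 HF HS.
  assert (Hcol : forall n, ex_series (fun m => F m n)).
  { intros n. apply ex_series_le_abs with (fun m => Series (F m)); [|exact HS].
    intros m. rewrite Rabs_pos_eq by apply H0.
    now apply term_le_Series. }
  split; [exact Hcol|].
  apply bounded_partial_sums.
  - intros n. apply Series_nonneg; [intros; apply H0|apply Hcol].
  - intros N. destruct (Series_sum_n F N Hcol) as [_ <-].
    apply Series_le; [|exact HS].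
    intros m. split.
    + rewrite sum_n_Reals. apply cond_pos_sum. intros; apply H0.
    + now apply partial_sum_le_Series.
Qed.

Lemma tonelli (F : nat -> nat -> R) :
  (forall m n, 0 <= F m n) ->
  (forall m, ex_series (F m)) -> ex_series (fun m => Series (F m)) ->
  (forall n, ex_series (fun m => F m n)) /\
  ex_series (fun n => Series (fun m => F m n)) /\
  Series (fun n => Series (fun m => F m n)) = Series (fun m => Series (F m)).
Proof.
  intros H0 HF HS.
  destruct (tonelli_le F H0 HF HS) as (H1 & H2 & H3).
  split; [exact H1|]. split; [exact H2|].
  apply Rle_antisym; [exact H3|].
  apply (tonelli_le (fun n m => F m n)); auto.
Qed.

(** Absolute convergence reduces to the nonnegative case by writing
    [F = (F + |F|) - |F|]. *)
Lemma fubini (F : nat -> nat -> R) :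
  (forall m, ex_series (fun n => Rabs (F m n))) ->
  ex_series (fun m => Series (fun n => Rabs (F m n))) ->
  (forall n, ex_series (fun m => Rabs (F m n))) /\
  ex_series (fun n => Series (fun m => Rabs (F m n))) /\
  Series (fun n => Series (fun m => F m n)) = Series (fun m => Series (F m)).
Proof.
  intros HF HS.
  set (A := fun m n => Rabs (F m n)).
  set (B := fun m n => 1 * F m n + 1 * Rabs (F m n)).
  assert (HF' : forall m, ex_series (F m)) by (intros m; now apply ex_series_Rabs).
  assert (HB : forall m n, 0 <= B m n <= 2 * A m n).
  { intros m n. unfold B, A. pose proof (Rle_abs (- F m n)) as Hn.
    rewrite Rabs_Ropp in Hn. pose proof (Rle_abs (F m n)). lra. }
  assert (HBr : forall m, ex_series (B m)) by (intros m; exact (ex_series_comb 1 1 _ _ (HF' m) (HF m))).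
  assert (HBs : ex_series (fun m => Series (B m))).
  { apply ex_series_le_abs with (fun m => 2 * Series (A m)).
    - intros m. rewrite Rabs_pos_eq.
      + rewrite <- Series_scal_l. apply Series_le; [apply HB|].
        apply (ex_series_scal_l 2 (A m)). apply HF.
      + apply Series_nonneg; [apply HB|apply HBr].
    - exact (ex_series_scal_l 2 _ HS). }
  destruct (tonelli A (fun m n => Rabs_pos _) HF HS) as (A1 & A2 & A3).
  destruct (tonelli B (fun m n => proj1 (HB m n)) HBr HBs) as (B1 & B2 & B3).
  split; [exact A1|]. split; [exact A2|].
  rewrite (Series_ext _ (fun n => 1 * Series (fun m => B m n)
                                  + (-1) * Series (fun m => A m n))).
  - rewrite Series_comb by assumption. rewrite A3, B3, <- Series_comb by assumption.
    apply Series_ext. intros m. rewrite <- Series_comb by (apply HBr || apply HF). unfold A, B.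
    apply Series_ext. intros n. ring.
  - intros n. rewrite <- Series_comb by (apply B1 || apply A1). unfold A, B.
    apply Series_ext. intros m. ring.
Qed.

Lemma is_lim_seq_double (u : nat -> R) (l : Rbar) :
  is_lim_seq u l -> is_lim_seq (fun n => u (2 * n + 1)%nat) l.
Proof.
  apply is_lim_seq_subseq with (phi := fun n => (2 * n + 1)%nat).
  intros P [N HN]. exists N. intros n Hn. apply HN. lia.
Qed.

Lemma Series_even_odd (u : nat -> R) :
  ex_series (fun n => u (2 * n)%nat) -> ex_series (fun n => u (2 * n + 1)%nat) ->
  ex_series u ->
  Series u = Series (fun n => u (2 * n)%nat) + Series (fun n => u (2 * n + 1)%nat).
Proof.
  intros H0 H1 H.
  rewrite <- Series_plus by assumption. symmetry.
  apply is_series_unique.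
  apply (is_lim_seq_ext (fun N => sum_n u (2 * N + 1)) _ (Series u)).
  - intros N. induction N as [|N IH].
    + simpl. now rewrite sum_Sn, !sum_O.
    + replace (2 * S N + 1)%nat with (S (S (2 * N + 1))) by lia.
      rewrite 3!sum_Sn, IH.
      replace (2 * S N)%nat with (S (2 * N + 1)) by lia.
      replace (S (2 * N + 1) + 1)%nat with (S (S (2 * N + 1))) by lia.
      exact (Rplus_assoc _ _ _).
  - apply (is_lim_seq_double (sum_n u) (Series u)).
    exact (Series_correct u H).
Qed.

(** * Sums over the integers *)

Definition zsummable (f : Z -> R) : Prop :=
  ex_series (fun n => Rabs (f (Z.of_nat n))) /\
  ex_series (fun n => Rabs (f (-1 - Z.of_nat n)%Z)).

Definition zsum (f : Z -> R) : R :=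
  Series (fun n => f (Z.of_nat n)) + Series (fun n => f (-1 - Z.of_nat n)%Z).

Lemma zsum_ext (f g : Z -> R) : (forall m, f m = g m) -> zsum f = zsum g.
Proof. intros H. unfold zsum. f_equal; apply Series_ext; intros n; apply H. Qed.

Lemma zsummable_le (f g : Z -> R) :
  (forall m, Rabs (f m) <= g m) -> zsummable g -> zsummable f.
Proof.
  intros H [H1 H2].
  split; [apply ex_series_le_abs with (2 := H1)|apply ex_series_le_abs with (2 := H2)];
    intros n; rewrite Rabs_Rabsolu;
    apply Rle_trans with (1 := H _); apply Rle_abs.
Qed.

Lemma zsummable_ext (f g : Z -> R) :
  (forall m, f m = g m) -> zsummable f -> zsummable g.
Proof.
  intros H [H1 H2].
  split; [apply ex_series_ext with (2 := H1)|apply ex_series_ext with (2 := H2)];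
    intros n; now rewrite H.
Qed.

Lemma zsummable_abs (f : Z -> R) : zsummable f -> zsummable (fun m => Rabs (f m)).
Proof.
  intros [H1 H2].
  split; [apply ex_series_ext with (2 := H1)|apply ex_series_ext with (2 := H2)];
    intros n; now rewrite Rabs_Rabsolu.
Qed.

Lemma zsummable_ex (f : Z -> R) :
  zsummable f -> ex_series (fun n => f (Z.of_nat n)) /\
                 ex_series (fun n => f (-1 - Z.of_nat n)%Z).
Proof. intros [H1 H2]. split; now apply ex_series_Rabs. Qed.

Lemma zsum_comb (c d : R) (f g : Z -> R) :
  zsummable f -> zsummable g ->
  zsum (fun m => c * f m + d * g m) = c * zsum f + d * zsum g.
Proof.
  intros Hf Hg. apply zsummable_ex in Hf as [F1 F2]. apply zsummable_ex in Hg as [G1 G2].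
  unfold zsum; cbv beta. rewrite !Series_comb by assumption. ring.
Qed.

Lemma zsummable_comb (c d : R) (f g : Z -> R) :
  zsummable f -> zsummable g -> zsummable (fun m => c * f m + d * g m).
Proof.
  intros Hf Hg.
  apply zsummable_le with (fun m => Rabs c * Rabs (f m) + Rabs d * Rabs (g m)).
  - intros m. rewrite <- !Rabs_mult. apply Rabs_triang.
  - apply zsummable_abs in Hf as [F1 F2]. apply zsummable_abs in Hg as [G1 G2].
    split.
    + eapply ex_series_ext; [|exact (ex_series_comb (Rabs c) (Rabs d) _ _ F1 G1)].
      intros n; cbv beta. rewrite !Rabs_Rabsolu, (Rabs_pos_eq (_ + _)); [reflexivity|].
      apply Rplus_le_le_0_compat; apply Rmult_le_pos; apply Rabs_pos.
    + eapply ex_series_ext; [|exact (ex_series_comb (Rabs c) (Rabs d) _ _ F2 G2)].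
      intros n; cbv beta. rewrite !Rabs_Rabsolu, (Rabs_pos_eq (_ + _)); [reflexivity|].
      apply Rplus_le_le_0_compat; apply Rmult_le_pos; apply Rabs_pos.
Qed.

Lemma zsum_scal (c : R) (f : Z -> R) : zsum (fun m => c * f m) = c * zsum f.
Proof. unfold zsum. rewrite !Series_scal_l. ring. Qed.

Lemma zsummable_scal (c : R) (f : Z -> R) :
  zsummable f -> zsummable (fun m => c * f m).
Proof.
  intros Hf. apply zsummable_ext with (fun m => c * f m + 0 * f m); [intros; ring|].
  now apply zsummable_comb.
Qed.

Lemma zsum_plus (f g : Z -> R) :
  zsummable f -> zsummable g -> zsum (fun m => f m + g m) = zsum f + zsum g.
Proof.
  intros Hf Hg.
  rewrite (zsum_ext _ (fun m => 1 * f m + 1 * g m)) by (intros; ring).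
  rewrite zsum_comb by assumption. ring.
Qed.

Lemma zsum_split_0 (f : Z -> R) :
  zsummable f ->
  zsum f = f 0%Z + (Series (fun n => f (Z.of_nat (S n)))
                    + Series (fun n => f (-1 - Z.of_nat n)%Z)).
Proof.
  intros Hf. apply zsummable_ex in Hf as [F1 _].
  unfold zsum; cbv beta. rewrite (Series_incr_1 (fun n => f (Z.of_nat n))) by assumption.
  simpl Z.of_nat at 1. ring.
Qed.

Lemma zsum_differ_at_0 (f g : Z -> R) :
  zsummable f -> zsummable g -> (forall d, d <> 0%Z -> f d = g d) ->
  zsum f - zsum g = f 0%Z - g 0%Z.
Proof.
  intros Hf Hg H. rewrite !zsum_split_0 by assumption.
  rewrite (Series_ext (fun n => f (Z.of_nat (S n))) (fun n => g (Z.of_nat (S n))))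
    by (intros; apply H; lia).
  rewrite (Series_ext (fun n => f (-1 - Z.of_nat n)%Z) (fun n => g (-1 - Z.of_nat n)%Z))
    by (intros; apply H; lia).
  ring.
Qed.

Lemma zsum_opp (f : Z -> R) :
  zsummable f ->
  zsummable (fun m => f (- m)%Z) /\ zsum (fun m => f (- m)%Z) = zsum f.
Proof.
  intros Hf. pose proof Hf as [F1 F2].
  assert (Hg : zsummable (fun m => f (- m)%Z)).
  { split.
    - apply ex_series_incr_1. apply ex_series_ext with (2 := F2).
      intros n. do 2 f_equal. lia.
    - apply ex_series_incr_1 in F1. apply ex_series_ext with (2 := F1).
      intros n. do 2 f_equal. lia. }
  split; [exact Hg|].
  rewrite !zsum_split_0 by assumption.
  rewrite (Series_ext (fun n => f (- Z.of_nat (S n))%Z) (fun n => f (-1 - Z.of_nat n)%Z))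
    by (intros; f_equal; lia).
  rewrite (Series_ext (fun n => f (- (-1 - Z.of_nat n))%Z) (fun n => f (Z.of_nat (S n))))
    by (intros; f_equal; lia).
  simpl (- 0)%Z. ring.
Qed.

Lemma zsum_succ (f : Z -> R) :
  zsummable f ->
  zsummable (fun m => f (m + 1)%Z) /\ zsum (fun m => f (m + 1)%Z) = zsum f.
Proof.
  intros Hf. pose proof Hf as [F1 F2].
  assert (Hg : zsummable (fun m => f (m + 1)%Z)).
  { split.
    - apply ex_series_incr_1 in F1. apply ex_series_ext with (2 := F1).
      intros n. do 2 f_equal. lia.
    - apply ex_series_incr_1. apply ex_series_ext with (2 := F2).
      intros n. do 2 f_equal. lia. }
  split; [exact Hg|].
  rewrite (zsum_split_0 f) by assumption.
  apply zsummable_ex in Hg as [_ G2].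
  unfold zsum; cbv beta. rewrite (Series_incr_1 (fun n => f (-1 - Z.of_nat n + 1)%Z)) by assumption.
  rewrite (Series_ext (fun n => f (Z.of_nat n + 1)%Z) (fun n => f (Z.of_nat (S n))))
    by (intros; f_equal; lia).
  rewrite (Series_ext (fun n => f (-1 - Z.of_nat (S n) + 1)%Z)
             (fun n => f (-1 - Z.of_nat n)%Z))
    by (intros; f_equal; lia).
  simpl (-1 - Z.of_nat 0 + 1)%Z. ring.
Qed.

Lemma zsum_pred (f : Z -> R) :
  zsummable f ->
  zsummable (fun m => f (m - 1)%Z) /\ zsum (fun m => f (m - 1)%Z) = zsum f.
Proof.
  intros Hf.
  destruct (zsum_opp f Hf) as [H1 E1].
  destruct (zsum_succ _ H1) as [H2 E2].
  destruct (zsum_opp _ H2) as [H3 E3].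
  split.
  - apply zsummable_ext with (2 := H3). intros m. cbv beta. f_equal. lia.
  - rewrite <- E1, <- E2, <- E3. apply zsum_ext. intros m. f_equal. lia.
Qed.

Lemma zsum_shift (d : Z) : forall f : Z -> R,
  zsummable f ->
  zsummable (fun m => f (m + d)%Z) /\ zsum (fun m => f (m + d)%Z) = zsum f.
Proof.
  induction d as [|d IH|d IH] using Z.peano_ind; intros f Hf.
  - split; [apply zsummable_ext with (2 := Hf)|apply zsum_ext]; intros m; f_equal; lia.
  - destruct (IH f Hf) as [H1 E1]. destruct (zsum_succ _ H1) as [H2 E2].
    split.
    + apply zsummable_ext with (2 := H2). intros m. cbv beta. f_equal. lia.
    + rewrite <- E1, <- E2. apply zsum_ext. intros m. f_equal. lia.
  - destruct (IH f Hf) as [H1 E1]. destruct (zsum_pred _ H1) as [H2 E2].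
    split.
    + apply zsummable_ext with (2 := H2). intros m. cbv beta. f_equal. lia.
    + rewrite <- E1, <- E2. apply zsum_ext. intros m. f_equal. lia.
Qed.

Lemma zsum_even_odd (f : Z -> R) :
  zsummable f -> zsummable (fun m => f (2 * m)%Z) -> zsummable (fun m => f (2 * m + 1)%Z) ->
  zsum f = zsum (fun m => f (2 * m)%Z) + zsum (fun m => f (2 * m + 1)%Z).
Proof.
  intros Hf H0 H1.
  apply zsummable_ex in Hf as [F1 F2]. apply zsummable_ex in H0 as [E1 E2].
  apply zsummable_ex in H1 as [O1 O2].
  assert (E1' : ex_series (fun n => f (Z.of_nat (2 * n)))).
  { apply ex_series_ext with (2 := E1). intros n. f_equal. lia. }
  assert (O1' : ex_series (fun n => f (Z.of_nat (2 * n + 1)))).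
  { apply ex_series_ext with (2 := O1). intros n. f_equal. lia. }
  assert (E2' : ex_series (fun n => f (-1 - Z.of_nat (2 * n + 1))%Z)).
  { apply ex_series_ext with (2 := E2). intros n. f_equal. lia. }
  assert (O2' : ex_series (fun n => f (-1 - Z.of_nat (2 * n))%Z)).
  { apply ex_series_ext with (2 := O2). intros n. f_equal. lia. }
  unfold zsum; cbv beta.
  rewrite (Series_even_odd (fun n => f (Z.of_nat n))) by assumption.
  rewrite (Series_even_odd (fun n => f (-1 - Z.of_nat n)%Z)) by assumption.
  rewrite (Series_ext (fun n => f (2 * Z.of_nat n)%Z) (fun n => f (Z.of_nat (2 * n))))
    by (intros; f_equal; lia).
  rewrite (Series_ext (fun n => f (2 * Z.of_nat n + 1)%Z) (fun n => f (Z.of_nat (2 * n + 1))))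
    by (intros; f_equal; lia).
  rewrite (Series_ext (fun n => f (2 * (-1 - Z.of_nat n))%Z)
             (fun n => f (-1 - Z.of_nat (2 * n + 1))%Z)) by (intros; f_equal; lia).
  rewrite (Series_ext (fun n => f (2 * (-1 - Z.of_nat n) + 1)%Z)
             (fun n => f (-1 - Z.of_nat (2 * n))%Z)) by (intros; f_equal; lia).
  ring.
Qed.

Lemma zfubini (F : Z -> Z -> R) :
  (forall m, zsummable (F m)) ->
  zsummable (fun m => zsum (fun d => Rabs (F m d))) ->
  (forall d, zsummable (fun m => F m d)) /\
  zsummable (fun d => zsum (fun m => F m d)) /\
  zsum (fun d => zsum (fun m => F m d)) = zsum (fun m => zsum (F m)).
Proof.
  intros HF [S1 S2].
  assert (Hrow : forall m,
     Series (fun n => Rabs (F m (Z.of_nat n))) <= zsum (fun d => Rabs (F m d)) /\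
     Series (fun n => Rabs (F m (-1 - Z.of_nat n)%Z)) <= zsum (fun d => Rabs (F m d)) /\
     0 <= Series (fun n => Rabs (F m (Z.of_nat n))) /\
     0 <= Series (fun n => Rabs (F m (-1 - Z.of_nat n)%Z))).
  { intros m. destruct (HF m) as [H1 H2].
    pose proof (Series_nonneg _ (fun n => Rabs_pos _) H1).
    pose proof (Series_nonneg _ (fun n => Rabs_pos _) H2).
    unfold zsum. lra. }
  assert (Hquad : forall s r : nat -> Z,
     (s = (fun n => Z.of_nat n) \/ s = (fun n => -1 - Z.of_nat n)%Z) ->
     (r = (fun n => Z.of_nat n) \/ r = (fun n => -1 - Z.of_nat n)%Z) ->
     (forall n, ex_series (fun m => Rabs (F (s m) (r n)))) /\
     ex_series (fun n => Series (fun m => Rabs (F (s m) (r n)))) /\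
     Series (fun n => Series (fun m => F (s m) (r n)))
     = Series (fun m => Series (fun n => F (s m) (r n)))).
  { intros s r Hs Hr. apply (fubini (fun m n => F (s m) (r n))).
    - intros m. destruct (HF (s m)). destruct Hr; subst r; assumption.
    - assert (Ss : ex_series (fun m => Rabs (zsum (fun d => Rabs (F (s m) d)))))
        by (destruct Hs; subst s; assumption).
      apply ex_series_le_abs with (2 := Ss). intros m.
      destruct (Hrow (s m)) as (A1 & A2 & A3 & A4).
      destruct Hr; subst r; rewrite Rabs_pos_eq by assumption;
        (eapply Rle_trans; [|apply Rle_abs]); assumption. }
  destruct (Hquad _ _ (or_introl eq_refl) (or_introl eq_refl)) as (A1 & A2 & A3).
  destruct (Hquad _ _ (or_introl eq_refl) (or_intror eq_refl)) as (B1 & B2 & B3).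
  destruct (Hquad _ _ (or_intror eq_refl) (or_introl eq_refl)) as (C1 & C2 & C3).
  destruct (Hquad _ _ (or_intror eq_refl) (or_intror eq_refl)) as (D1 & D2 & D3).
  clear Hquad.
  assert (Habs : forall u : nat -> nat -> R,
     (forall n, ex_series (fun m => Rabs (u m n))) ->
     ex_series (fun n => Series (fun m => Rabs (u m n))) ->
     ex_series (fun n => Rabs (Series (fun m => u m n)))).
  { intros u H1 H2. apply ex_series_le_abs with (2 := H2).
    intros n. rewrite Rabs_Rabsolu. now apply Series_Rabs. }
  assert (Hsum : forall u v : nat -> R,
     ex_series (fun n => Rabs (u n)) -> ex_series (fun n => Rabs (v n)) ->
     ex_series (fun n => Rabs (u n + v n))).
  { intros u v Hu Hv.
    apply ex_series_le_abs with (2 := ex_series_comb 1 1 _ _ Hu Hv).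
    intros n. rewrite Rabs_Rabsolu. rewrite !Rmult_1_l. apply Rabs_triang. }
  pose proof (Habs _ A1 A2) as A4. pose proof (Habs _ B1 B2) as B4.
  pose proof (Habs _ C1 C2) as C4. pose proof (Habs _ D1 D2) as D4.
  assert (Hcol : forall d, zsummable (fun m => F m d)).
  { intros d. destruct (Z_le_gt_dec 0 d).
    - replace d with (Z.of_nat (Z.to_nat d)) by lia. split; [apply A1|apply C1].
    - replace d with (-1 - Z.of_nat (Z.to_nat (-1 - d)))%Z by lia.
      split; [apply B1|apply D1]. }
  split; [exact Hcol|]. split.
  { split; unfold zsum; [exact (Hsum _ _ A4 C4)|exact (Hsum _ _ B4 D4)]. }
  assert (Hrow' : forall s r : nat -> Z,
     (s = (fun n => Z.of_nat n) \/ s = (fun n => -1 - Z.of_nat n)%Z) ->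
     (r = (fun n => Z.of_nat n) \/ r = (fun n => -1 - Z.of_nat n)%Z) ->
     ex_series (fun m => Series (fun n => F (s m) (r n)))).
  { intros s r Hs Hr.
    assert (Ss : ex_series (fun m => Rabs (zsum (fun d => Rabs (F (s m) d)))))
        by (destruct Hs; subst s; assumption).
    apply ex_series_le_abs with (2 := Ss). intros m.
    destruct (Hrow (s m)) as (X1 & X2 & X3 & X4).
    destruct (HF (s m)) as [Y1 Y2].
    destruct Hr; subst r; (eapply Rle_trans; [apply Series_Rabs; assumption|]);
        (eapply Rle_trans; [|apply Rle_abs]); assumption. }
  pose proof (Hrow' _ _ (or_introl eq_refl) (or_introl eq_refl)) as R1.
  pose proof (Hrow' _ _ (or_introl eq_refl) (or_intror eq_refl)) as R2.
  pose proof (Hrow' _ _ (or_intror eq_refl) (or_introl eq_refl)) as R3.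
  pose proof (Hrow' _ _ (or_intror eq_refl) (or_intror eq_refl)) as R4.
  cbv beta in R1, R2, R3, R4.
  unfold zsum; cbv beta.
  rewrite !Series_plus by (assumption || now apply ex_series_Rabs).
  lra.
Qed.

(** The product of two sums is rearranged by the difference [d] of the indices,
    because for terms taken along an arithmetic progression a hyperbolic addition
    formula evaluates each diagonal sum. *)
Lemma zsum_mult_diagonals (u v : Z -> R) :
  zsummable u -> zsummable v ->
  (forall d, zsummable (fun m => u m * v (m + d)%Z)) /\
  zsummable (fun d => zsum (fun m => u m * v (m + d)%Z)) /\
  zsum (fun d => zsum (fun m => u m * v (m + d)%Z)) = zsum u * zsum v.
Proof.
  intros Hu Hv.
  assert (Hs : forall m, zsummable (fun d => v (m + d)%Z) /\
                         zsum (fun d => v (m + d)%Z) = zsum v).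
  { intros m. destruct (zsum_shift m v Hv) as [H1 E1]. split.
    - apply zsummable_ext with (2 := H1). intros d. now rewrite Z.add_comm.
    - rewrite <- E1. apply zsum_ext. intros d. now rewrite Z.add_comm. }
  assert (Hsa : forall m, zsum (fun d => Rabs (v (m + d)%Z)) = zsum (fun d => Rabs (v d))).
  { intros m. destruct (zsum_shift m _ (zsummable_abs v Hv)) as [_ E1].
    rewrite <- E1. apply zsum_ext. intros d. now rewrite Z.add_comm. }
  destruct (zfubini (fun m d => u m * v (m + d)%Z)) as (H1 & H2 & H3).
  - intros m. apply zsummable_scal. apply Hs.
  - apply zsummable_ext with (fun m => zsum (fun d => Rabs (v d)) * Rabs (u m)).
    + intros m. rewrite <- (Hsa m), Rmult_comm, <- zsum_scal. apply zsum_ext.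
      intros d. now rewrite Rabs_mult.
    + apply zsummable_scal. now apply zsummable_abs.
  - split; [exact H1|]. split; [exact H2|]. rewrite H3.
    rewrite (zsum_ext _ (fun m => zsum v * u m)).
    + rewrite zsum_scal. ring.
    + intros m. rewrite zsum_scal. rewrite (proj2 (Hs m)). ring.
Qed.

Lemma is_series_telescope (w : nat -> R) (l : R) :
  is_lim_seq w l -> is_series (fun n => w (S n) - w n) (l - w 0%nat).
Proof.
  intros Hw.
  assert (H : is_lim_seq (fun n => w (S n) - w 0%nat) (l - w 0%nat)).
  { apply is_lim_seq_minus'; [|apply is_lim_seq_const].
    now apply is_lim_seq_incr_1 in Hw. }
  apply is_lim_seq_ext with (2 := H).
  intros n. induction n as [|n IH].
  - now rewrite sum_O.
  - rewrite sum_Sn, <- IH. unfold plus; simpl. ring.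
Qed.

Lemma zsum_telescope (w : Z -> R) (lp lm : R) :
  is_lim_seq (fun n => w (Z.of_nat n)) lp ->
  is_lim_seq (fun n => w (- Z.of_nat n)%Z) lm ->
  zsum (fun m => w (m + 1)%Z - w m) = lp - lm.
Proof.
  intros Hp Hm. unfold zsum.
  rewrite (Series_ext _ (fun n => w (Z.of_nat (S n)) - w (Z.of_nat n)))
    by (intros; do 2 f_equal; lia).
  rewrite (Series_ext (fun n => w (-1 - Z.of_nat n + 1)%Z - w (-1 - Z.of_nat n)%Z)
            (fun n => - w (- Z.of_nat (S n))%Z - - w (- Z.of_nat n)%Z)).
  2:{ intros n. replace (-1 - Z.of_nat n + 1)%Z with (- Z.of_nat n)%Z by lia.
      replace (-1 - Z.of_nat n)%Z with (- Z.of_nat (S n))%Z by lia. ring. }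
  rewrite (is_series_unique _ _ (is_series_telescope (fun n => w (Z.of_nat n)) lp Hp)).
  apply is_lim_seq_opp in Hm.
  rewrite (is_series_unique _ _
             (is_series_telescope (fun n => - w (- Z.of_nat n)%Z) (- lm) Hm)).
  simpl (Z.of_nat 0). simpl (- 0)%Z. ring.
Qed.

Lemma zsum_telescope_step (w : Z -> R) (lp lm : R) :
  is_lim_seq (fun n => w (Z.of_nat n)) lp ->
  is_lim_seq (fun n => w (- Z.of_nat n)%Z) lm ->
  (forall d, zsummable (fun m => w (m + d)%Z - w m)) ->
  forall d, zsum (fun m => w (m + d)%Z - w m) = IZR d * (lp - lm).
Proof.
  intros Hp Hm Hs.
  assert (step : forall d, zsum (fun m => w (m + Z.succ d)%Z - w m)
                           = zsum (fun m => w (m + d)%Z - w m) + (lp - lm)).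
  { intros d.
    destruct (zsum_shift d _ (Hs 1%Z)) as [H1 E1].
    rewrite (zsum_telescope w lp lm Hp Hm) in E1.
    rewrite <- E1, <- zsum_plus by auto.
    apply zsum_ext. intros m.
    replace (m + Z.succ d)%Z with (m + d + 1)%Z by lia. ring. }
  intros d. induction d as [|d IH|d IH] using Z.peano_ind.
  - rewrite (zsum_ext _ (fun m => 0 * 0)).
    + rewrite zsum_scal. simpl. ring.
    + intros m. rewrite Z.add_0_r. ring.
  - rewrite step, IH, succ_IZR. ring.
  - specialize (step (Z.pred d)). rewrite Z.succ_pred, IH in step.
    rewrite <- Z.sub_1_r in *. rewrite minus_IZR. lra.
Qed.

(** * Hyperbolic functions *)

Definition sech (x : R) : R := / cosh x.

Lemma cosh_opp (x : R) : cosh (- x) = cosh x.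
Proof. unfold cosh. rewrite Ropp_involutive. lra. Qed.

Lemma sinh_opp (x : R) : sinh (- x) = - sinh x.
Proof. unfold sinh. rewrite Ropp_involutive. lra. Qed.

Lemma cosh_plus (x y : R) : cosh (x + y) = cosh x * cosh y + sinh x * sinh y.
Proof. unfold cosh, sinh. rewrite Ropp_plus_distr, !exp_plus. field. Qed.

Lemma sinh_plus (x y : R) : sinh (x + y) = sinh x * cosh y + cosh x * sinh y.
Proof. unfold cosh, sinh. rewrite Ropp_plus_distr, !exp_plus. field. Qed.

Lemma cosh_sq (x : R) : cosh x ^ 2 = 1 + sinh x ^ 2.
Proof.
  pose proof (cosh_plus x (- x)) as H. rewrite cosh_opp, sinh_opp in H.
  rewrite Rplus_opp_r, cosh_0 in H. lra.
Qed.

Lemma cosh_ge_1 (x : R) : 1 <= cosh x.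
Proof.
  assert (0 < cosh x).
  { unfold cosh. pose proof (exp_pos x). pose proof (exp_pos (- x)). lra. }
  pose proof (cosh_sq x). nra.
Qed.

Lemma cosh_neq_0 (x : R) : cosh x <> 0.
Proof. pose proof (cosh_ge_1 x). lra. Qed.

Lemma sinh_neq_0 (x : R) : x <> 0 -> sinh x <> 0.
Proof.
  intros H. destruct (Rdichotomy _ _ H) as [H'|H'].
  - pose proof (sinh_lt _ _ H'). rewrite sinh_0 in *. lra.
  - pose proof (sinh_lt _ _ H'). rewrite sinh_0 in *. lra.
Qed.

Lemma sech_opp (x : R) : sech (- x) = sech x.
Proof. unfold sech. now rewrite cosh_opp. Qed.

Lemma sech_bounds (x : R) : 0 < sech x <= 1.
Proof.
  unfold sech. pose proof (cosh_ge_1 x). split.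
  - apply Rinv_0_lt_compat. lra.
  - rewrite <- Rinv_1. apply Rinv_le_contravar; lra.
Qed.

Lemma sech_le_exp (x : R) : sech x <= 2 * exp (- x).
Proof.
  unfold sech. pose proof (cosh_ge_1 x).
  apply Rmult_le_reg_r with (cosh x); [lra|].
  rewrite Rinv_l by lra. unfold cosh.
  assert (E : exp (- x) * exp x = 1) by (rewrite <- exp_plus, Rplus_opp_l; apply exp_0).
  pose proof (exp_pos (- x)). nra.
Qed.

Lemma tanh_increment (x d : R) :
  tanh (x + d) - tanh x = sinh d * (sech x * sech (x + d)).
Proof.
  unfold tanh, sech.
  replace (sinh d) with (sinh (x + d) * cosh x - cosh (x + d) * sinh x).
  - field. split; apply cosh_neq_0.
  - replace d with (x + d + - x) at 3 by ring.
    rewrite (sinh_plus (x + d) (- x)), cosh_opp, sinh_opp. ring.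
Qed.

(** * The sums of sech over an arithmetic progression *)

Lemma exp_mult_nat (t : R) (n : nat) : exp (INR n * t) = exp t ^ n.
Proof.
  induction n as [|n IH]; [simpl; rewrite Rmult_0_l; apply exp_0|].
  rewrite S_INR, Rmult_plus_distr_r, exp_plus, IH, Rmult_1_l. simpl. ring.
Qed.

Lemma ex_series_sech_progression (x t : R) :
  0 < t -> ex_series (fun n => sech (x + INR n * t)).
Proof.
  intros Ht.
  apply ex_series_le_abs with (fun n => 2 * exp (- x) * exp (- t) ^ n).
  - intros n. rewrite Rabs_pos_eq by (apply Rlt_le, sech_bounds).
    apply Rle_trans with (1 := sech_le_exp _).
    rewrite <- exp_mult_nat, Rmult_assoc, <- exp_plus.
    right. do 2 f_equal. ring.
  - apply (ex_series_scal_l (2 * exp (- x)) (pow (exp (- t)))), ex_series_geom.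
    rewrite Rabs_pos_eq by (apply Rlt_le, exp_pos).
    rewrite <- exp_0. apply exp_increasing. lra.
Qed.

Lemma zsummable_sech (t x : R) :
  0 < t -> zsummable (fun m => sech (x + IZR m * t)).
Proof.
  intros Ht. split.
  - apply ex_series_ext with (2 := ex_series_sech_progression x t Ht).
    intros n. rewrite <- INR_IZR_INZ.
    now rewrite Rabs_pos_eq by (apply Rlt_le, sech_bounds).
  - apply ex_series_ext with (2 := ex_series_sech_progression (t - x) t Ht).
    intros n. rewrite Rabs_pos_eq by (apply Rlt_le, sech_bounds).
    rewrite <- sech_opp. f_equal. rewrite minus_IZR, <- INR_IZR_INZ. ring.
Qed.

Lemma zsummable_sech_mult (t x : R) (h : Z -> R) :
  0 < t -> (forall m, Rabs (h m) <= 1) ->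
  zsummable (fun m => sech (x + IZR m * t) * h m).
Proof.
  intros Ht Hh. apply zsummable_le with (2 := zsummable_sech t x Ht).
  intros m. rewrite Rabs_mult.
  pose proof (sech_bounds (x + IZR m * t)). rewrite (Rabs_pos_eq (sech _)) by lra.
  specialize (Hh m). pose proof (Rabs_pos (h m)). nra.
Qed.

Lemma sech_power_le_1 (x : R) (n : nat) : Rabs (sech x ^ n) <= 1.
Proof.
  pose proof (sech_bounds x). rewrite Rabs_pos_eq by (apply pow_le; lra).
  rewrite <- (pow1 n). apply pow_incr. lra.
Qed.

Definition sech_pow_sum (p : nat) (t x : R) : R :=
  zsum (fun m => sech (x + IZR m * t) ^ p).

Lemma zsummable_sech_pow (p : nat) (t x : R) :
  0 < t -> zsummable (fun m => sech (x + IZR m * t) ^ S p).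
Proof. intros Ht. apply zsummable_sech_mult; [exact Ht|]. intros; apply sech_power_le_1. Qed.

Lemma sech_pow_sum_opp (p : nat) (t x : R) :
  0 < t -> sech_pow_sum (S p) t (- x) = sech_pow_sum (S p) t x.
Proof.
  intros Ht. unfold sech_pow_sum.
  rewrite <- (proj2 (zsum_opp _ (zsummable_sech_pow p t (- x) Ht))).
  apply zsum_ext. intros m. f_equal. rewrite <- sech_opp. f_equal.
  rewrite opp_IZR. ring.
Qed.

Lemma sech_pow_sum_period (p : nat) (t x : R) :
  0 < t -> sech_pow_sum (S p) t (x + t) = sech_pow_sum (S p) t x.
Proof.
  intros Ht. unfold sech_pow_sum.
  rewrite <- (proj2 (zsum_shift 1 _ (zsummable_sech_pow p t x Ht))).
  apply zsum_ext. intros m. do 2 f_equal. rewrite plus_IZR. ring.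
Qed.

Lemma sech_pow_sum_duplication (p : nat) (t x : R) :
  0 < t ->
  sech_pow_sum (S p) t x = sech_pow_sum (S p) (2 * t) x + sech_pow_sum (S p) (2 * t) (x + t).
Proof.
  intros Ht. assert (Ht2 : 0 < 2 * t) by lra. unfold sech_pow_sum.
  assert (E0 : forall m, sech (x + IZR m * (2 * t)) ^ S p = sech (x + IZR (2 * m) * t) ^ S p)
    by (intros m; rewrite mult_IZR; do 2 f_equal; ring).
  assert (E1 : forall m,
    sech (x + t + IZR m * (2 * t)) ^ S p = sech (x + IZR (2 * m + 1) * t) ^ S p)
    by (intros m; rewrite plus_IZR, mult_IZR; do 2 f_equal; ring).
  rewrite (zsum_ext _ _ E0), (zsum_ext _ _ E1).
  apply (zsum_even_odd (fun m => sech (x + IZR m * t) ^ S p)).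
  - now apply zsummable_sech_pow.
  - apply zsummable_ext with (1 := E0). now apply zsummable_sech_pow.
  - apply zsummable_ext with (1 := E1). now apply zsummable_sech_pow.
Qed.

Lemma tanh_progression_lim (t x : R) :
  0 < t -> is_lim_seq (fun n => tanh (x + INR n * t)) 1.
Proof.
  intros Ht.
  assert (H0 : is_lim_seq (fun n => exp (- x) * sech (x + INR n * t)) 0).
  { replace (Finite 0) with (Rbar_mult (exp (- x)) 0) by (simpl; now rewrite Rmult_0_r).
    apply is_lim_seq_scal_l. apply ex_series_lim_0. now apply ex_series_sech_progression. }
  apply is_lim_seq_le_le with (fun n => 1 - exp (- x) * sech (x + INR n * t)) (fun _ => 1).
  - intros n. set (z := x + INR n * t).
    assert (E : tanh z = 1 - exp (- z) * sech z).
    { unfold tanh, sech. field_simplify_eq; [|apply cosh_neq_0].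
      unfold cosh, sinh. field. }
    assert (exp (- z) <= exp (- x)).
    { assert (Hz : x <= z) by (unfold z; pose proof (pos_INR n); nra).
      destruct Hz as [Hz|Hz]; [|rewrite Hz; lra].
      left. apply exp_increasing. lra. }
    pose proof (sech_bounds z). pose proof (exp_pos (- z)). rewrite E. nra.
  - replace (Finite 1) with (Finite (1 - 0)) by (f_equal; ring).
    apply is_lim_seq_minus'; [apply is_lim_seq_const|exact H0].
  - apply is_lim_seq_const.
Qed.

Lemma tanh_opp (x : R) : tanh (- x) = - tanh x.
Proof. unfold tanh. rewrite sinh_opp, cosh_opp. field. apply cosh_neq_0. Qed.

Lemma zsummable_tanh_increment (t x d : R) :
  0 < t -> zsummable (fun m => tanh (x + IZR m * t + d) - tanh (x + IZR m * t)).
Proof.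
  intros Ht.
  apply zsummable_ext
    with (fun m => sinh d * (sech (x + IZR m * t) * sech (x + IZR m * t + d))).
  - intros m. now rewrite tanh_increment.
  - apply zsummable_scal. apply zsummable_sech_mult; [exact Ht|].
    intros m. rewrite <- (pow_1 (sech _)). apply sech_power_le_1.
Qed.

(** The increments over one period telescope to [tanh (+oo) - tanh (-oo) = 2]. *)
Lemma zsum_tanh_shift (t x : R) (d : Z) :
  0 < t ->
  zsum (fun m => tanh (x + IZR m * t + IZR d * t) - tanh (x + IZR m * t)) = 2 * IZR d.
Proof.
  intros Ht.
  rewrite (zsum_ext _ (fun m => tanh (x + IZR (m + d) * t) - tanh (x + IZR m * t))).
  2:{ intros m. rewrite plus_IZR. do 2 f_equal. ring. }
  rewrite (zsum_telescope_step (fun m => tanh (x + IZR m * t)) 1 (-1)).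
  - ring.
  - apply is_lim_seq_ext with (2 := tanh_progression_lim t x Ht).
    intros n. now rewrite INR_IZR_INZ.
  - apply is_lim_seq_ext with (fun n => - tanh (- x + INR n * t)).
    + intros n. rewrite <- tanh_opp, opp_IZR, <- INR_IZR_INZ. f_equal. ring.
    + apply (is_lim_seq_opp _ 1). now apply tanh_progression_lim.
  - intros e. apply zsummable_ext with (2 := zsummable_tanh_increment t x (IZR e * t) Ht).
    intros m. rewrite plus_IZR. do 2 f_equal. ring.
Qed.

(** * Quadratic and cubic relations between the sums *)

Lemma sech_prod (x d : R) :
  d <> 0 -> sech x * sech (x + d) = / sinh d * (tanh (x + d) - tanh x).
Proof.
  intros Hd. rewrite tanh_increment, <- Rmult_assoc, Rinv_l, Rmult_1_l; [easy|].
  now apply sinh_neq_0.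
Qed.

Lemma zsum_sech_prod (t x : R) (d : Z) :
  0 < t -> d <> 0%Z ->
  zsum (fun m => sech (x + IZR m * t) * sech (x + IZR (m + d) * t))
  = 2 * IZR d / sinh (IZR d * t).
Proof.
  intros Ht Hd.
  assert (Hd' : IZR d * t <> 0).
  { apply Rmult_integral_contrapositive_currified; [|lra]. now apply not_0_IZR. }
  rewrite (zsum_ext _ (fun m => / sinh (IZR d * t) *
     (tanh (x + IZR m * t + IZR d * t) - tanh (x + IZR m * t)))).
  - rewrite zsum_scal, zsum_tanh_shift by assumption. unfold Rdiv. ring.
  - intros m. rewrite <- sech_prod by assumption. do 2 f_equal. rewrite plus_IZR. ring.
Qed.

(** In the square of the sum at [x], the diagonal of difference [d <> 0] sums to
    [2 d / sinh (d t)] whatever [x] is, so it cancels in the difference, and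
    only the squares of the terms survive. *)
Lemma sech_sum_sq_diff (t x y : R) :
  0 < t ->
  sech_pow_sum 1 t x ^ 2 - sech_pow_sum 1 t y ^ 2
  = sech_pow_sum 2 t x - sech_pow_sum 2 t y.
Proof.
  intros Ht.
  pose proof (zsummable_sech_pow 0 t x Ht) as Hx.
  pose proof (zsummable_sech_pow 0 t y Ht) as Hy.
  destruct (zsum_mult_diagonals _ _ Hx Hx) as (_ & X2 & X3).
  destruct (zsum_mult_diagonals _ _ Hy Hy) as (_ & Y2 & Y3).
  pose proof (zsum_differ_at_0 _ _ X2 Y2) as D.
  rewrite X3, Y3 in D. unfold sech_pow_sum.
  rewrite <- !Rsqr_pow2. unfold Rsqr. rewrite D.
  - f_equal; apply zsum_ext; intros m; rewrite Z.add_0_r; ring.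
  - intros d Hd.
    transitivity (2 * IZR d / sinh (IZR d * t)); [|symmetry].
    + rewrite <- (zsum_sech_prod t x d Ht Hd). apply zsum_ext. intros; ring.
    + rewrite <- (zsum_sech_prod t y d Ht Hd). apply zsum_ext. intros; ring.
Qed.

(** What matters is that the right-hand side does not involve [x]: this is the
    constancy of [dn (u) dn (u + K)]. The differences [(d + 1/2) t] between the
    arguments come in opposite pairs [d], [-1 - d]; adding the two contributions
    leaves a sum of increments of tanh over [2 d + 1] periods, which telescopes. *)
Lemma sech_sum_half_period (t x : R) :
  0 < t ->
  2 * (sech_pow_sum 1 t x * sech_pow_sum 1 t (x + t / 2))
  = zsum (fun d => 2 * IZR (2 * d + 1) / sinh ((IZR d + 1 / 2) * t)).
Proof.
  intros Ht.
  destruct (zsum_mult_diagonals _ _ (zsummable_sech_pow 0 t x Ht)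
              (zsummable_sech_pow 0 t (x + t / 2) Ht)) as (X1 & X2 & X3).
  destruct (zsum_opp _ X2) as [O1 O2].
  destruct (zsum_shift 1 _ O1) as [S1 S2].
  unfold sech_pow_sum. rewrite <- X3.
  match goal with |- 2 * ?s = _ => replace (2 * s) with (s + s) by ring end.
  rewrite <- O2 at 2. rewrite <- S2. rewrite <- zsum_plus by assumption.
  apply zsum_ext. intros d. cbv beta.
  rewrite <- zsum_plus by apply X1.
  set (e := (IZR d + 1 / 2) * t).
  assert (He : e <> 0).
  { apply Rmult_integral_contrapositive_currified; [|lra].
    intros H. assert (H' : IZR (2 * d + 1) = 0) by (rewrite plus_IZR, mult_IZR; lra).
    apply eq_IZR in H'. lia. }
  rewrite (zsum_ext _ (fun m => / sinh e *
     (tanh (x - e + IZR m * t + IZR (2 * d + 1) * t) - tanh (x - e + IZR m * t)))).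
  - rewrite zsum_scal, zsum_tanh_shift by assumption. unfold Rdiv. ring.
  - intros m. set (z := x + IZR m * t). simpl pow. rewrite !Rmult_1_r.
    replace (x + t / 2 + IZR (m + d) * t) with (z + e)
      by (unfold z, e; rewrite plus_IZR; field).
    replace (x + t / 2 + IZR (m + - (d + 1)) * t) with (z + - e)
      by (unfold z, e; rewrite plus_IZR, opp_IZR, plus_IZR; field).
    replace (x - e + IZR m * t + IZR (2 * d + 1) * t) with (z + e)
      by (unfold z, e; rewrite plus_IZR, mult_IZR; field).
    replace (x - e + IZR m * t) with (z + - e) by (unfold z; ring).
    rewrite sech_prod by assumption. rewrite (sech_prod z (- e)) by lra.
    rewrite sinh_opp. field. now apply sinh_neq_0.
Qed.

(** Compare the products at the points [0] and [- t / 4]. *)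
Lemma sech_sum_quarter_period (t : R) :
  0 < t ->
  sech_pow_sum 1 t (t / 4) ^ 2 = sech_pow_sum 1 t 0 * sech_pow_sum 1 t (t / 2).
Proof.
  intros Ht.
  pose proof (sech_sum_half_period t 0 Ht) as H0.
  pose proof (sech_sum_half_period t (- (t / 4)) Ht) as H1.
  rewrite <- H0, sech_pow_sum_opp in H1 by assumption.
  replace (- (t / 4) + t / 2) with (t / 4) in H1 by field.
  rewrite Rplus_0_l in H1. lra.
Qed.

(** Unlike the left-hand side, the right-hand side is linear in functions of a
    single argument; its first term is odd in [x] and drops out of the sum over
    the progression through [0]. *)
Lemma sech_sq_prod (x d : R) :
  d <> 0 ->
  sech x ^ 2 * sech (x + d)
  = - / sinh d * (sech x * tanh x)
    + (cosh d / sinh d ^ 2 * sech x - / sinh d ^ 2 * sech (x + d)).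
Proof.
  intros Hd. apply sinh_neq_0 in Hd.
  pose proof (cosh_neq_0 x). pose proof (cosh_neq_0 (x + d)).
  pose proof (cosh_sq x) as E. pose proof (cosh_sq d) as E'.
  unfold sech, tanh. field_simplify_eq; [|tauto].
  rewrite cosh_plus.
  transitivity (cosh x ^ 2 * cosh d ^ 2 - cosh x ^ 2 - sinh x ^ 2 * sinh d ^ 2);
    [rewrite E, E'|]; ring.
Qed.

Lemma zsum_sech_sq_prod (t : R) (d : Z) :
  0 < t -> d <> 0%Z ->
  zsum (fun m => sech (0 + IZR m * t) ^ 2 * sech (0 + IZR (m + d) * t) ^ 1)
  = sech_pow_sum 1 t 0 / 2 * sech (0 + IZR d * (t / 2)) ^ 2.
Proof.
  intros Ht Hd.
  set (e := IZR d * t).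
  assert (He : e <> 0).
  { apply Rmult_integral_contrapositive_currified; [|lra]. now apply not_0_IZR. }
  pose proof (zsummable_sech_pow 0 t 0 Ht) as Hs.
  destruct (zsum_shift d _ Hs) as [Hs' Es].
  assert (Ht' : zsummable (fun m => sech (0 + IZR m * t) * tanh (0 + IZR m * t))).
  { apply zsummable_sech_mult; [exact Ht|]. intros m.
    set (x := 0 + IZR m * t).
    pose proof (cosh_sq x). pose proof (cosh_ge_1 x).
    unfold tanh, Rdiv. rewrite Rabs_mult, Rabs_inv, (Rabs_pos_eq (cosh x)) by lra.
    apply Rmult_le_reg_r with (cosh x); [lra|].
    rewrite Rmult_assoc, Rinv_l, Rmult_1_r, Rmult_1_l by lra.
    apply Rabs_le. nra. }
  assert (Eodd : zsum (fun m => sech (0 + IZR m * t) * tanh (0 + IZR m * t)) = 0).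
  { destruct (zsum_opp _ Ht') as [_ E].
    rewrite (zsum_ext _ (fun m => -1 * (sech (0 + IZR m * t) * tanh (0 + IZR m * t)))) in E.
    - rewrite zsum_scal in E. lra.
    - intros m. rewrite opp_IZR.
      replace (0 + - IZR m * t) with (- (0 + IZR m * t)) by ring.
      rewrite sech_opp, tanh_opp. ring. }
  rewrite (zsum_ext _ (fun m =>
     - / sinh e * (sech (0 + IZR m * t) * tanh (0 + IZR m * t))
     + 1 * (cosh e / sinh e ^ 2 * sech (0 + IZR m * t) ^ 1
            + - / sinh e ^ 2 * sech (0 + IZR (m + d) * t) ^ 1))).
  - rewrite zsum_comb, zsum_comb by (assumption || now apply zsummable_comb).
    rewrite Eodd, Es. fold (sech_pow_sum 1 t 0).
    replace (0 + IZR d * (t / 2)) with (e / 2) by (unfold e; field).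
    assert (Hh : sinh (e / 2) <> 0) by (apply sinh_neq_0; lra).
    assert (Esinh : sinh e = 2 * sinh (e / 2) * cosh (e / 2)).
    { replace e with (e / 2 + e / 2) at 1 by field. rewrite sinh_plus. ring. }
    assert (Ecosh : cosh e = cosh (e / 2) ^ 2 + sinh (e / 2) ^ 2).
    { replace e with (e / 2 + e / 2) at 1 by field. rewrite cosh_plus. ring. }
    rewrite Esinh, Ecosh.
    pose proof (cosh_neq_0 (e / 2)). pose proof (cosh_sq (e / 2)) as E.
    unfold sech. field_simplify_eq; [|split; assumption].
    rewrite E. ring.
  - intros m. rewrite plus_IZR, Rmult_plus_distr_r. fold e.
    rewrite <- Rplus_assoc, !pow_1, sech_sq_prod by assumption. ring.
Qed.

(** Expand the product of the sums of [sech^2] and [sech] along diagonals. The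
    off-diagonal contributions carry the factors [sech (d t / 2) ^ 2], and the
    points [d t / 2] are those of the progressions of step [t] through [0] and
    [t / 2] together. *)
Lemma sech_cube_sum (t : R) :
  0 < t ->
  2 * sech_pow_sum 3 t 0 - sech_pow_sum 1 t 0
  = sech_pow_sum 1 t 0 * (sech_pow_sum 1 t 0 ^ 2 - sech_pow_sum 1 t (t / 2) ^ 2).
Proof.
  intros Ht. assert (Ht2 : 0 < t / 2) by lra.
  destruct (zsum_mult_diagonals _ _ (zsummable_sech_pow 1 t 0 Ht)
              (zsummable_sech_pow 0 t 0 Ht)) as (X1 & X2 & X3).
  pose proof (zsummable_scal (sech_pow_sum 1 t 0 / 2) _
                (zsummable_sech_pow 1 (t / 2) 0 Ht2)) as Y2.
  pose proof (zsum_differ_at_0 _ _ X2 Y2) as D.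
  rewrite X3, zsum_scal in D.
  fold (sech_pow_sum 2 (t / 2) 0) (sech_pow_sum 2 t 0) (sech_pow_sum 1 t 0) in D.
  rewrite (sech_pow_sum_duplication 1 (t / 2)) in D by assumption.
  replace (2 * (t / 2)) with t in D by field.
  rewrite Rplus_0_l in D.
  rewrite sech_sum_sq_diff by assumption.
  specialize (D (fun d Hd => zsum_sech_sq_prod t d Ht Hd)).
  rewrite (zsum_ext _ (fun m => sech (0 + IZR m * t) ^ 3)) in D.
  2:{ intros m. rewrite Z.add_0_r. ring. }
  fold (sech_pow_sum 3 t 0) in D.
  rewrite Rmult_0_l, Rplus_0_l in D.
  assert (S0 : sech 0 = 1) by (unfold sech; rewrite cosh_0; apply Rinv_1).
  rewrite S0 in D. nra.
Qed.

(** * The arithmetic-geometric mean relations *)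

Definition period_sum (t : R) : R := sech_pow_sum 1 t 0.
Definition half_period_sum (t : R) : R := sech_pow_sum 1 t (t / 2).

Lemma period_sum_duplication (t : R) :
  0 < t -> period_sum t = period_sum (2 * t) + half_period_sum (2 * t).
Proof.
  intros Ht. unfold period_sum, half_period_sum.
  rewrite (sech_pow_sum_duplication 0 t 0 Ht). do 2 f_equal. field.
Qed.

(** The progression of step [t] through [t / 2] splits into those of step [2 t]
    through [t / 2] and [- t / 2]. These are reflections of each other, and
    [t / 2] is a quarter of the step. *)
Lemma half_period_sum_duplication (t : R) :
  0 < t -> half_period_sum t ^ 2 = 4 * (period_sum (2 * t) * half_period_sum (2 * t)).
Proof.
  intros Ht. unfold period_sum, half_period_sum.
  rewrite (sech_pow_sum_duplication 0 t _ Ht).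
  rewrite <- (sech_sum_quarter_period (2 * t)) by lra.
  replace (2 * t / 4) with (t / 2) by field.
  replace (t / 2 + t) with (- (t / 2) + 2 * t) by field.
  rewrite (sech_pow_sum_period 0) by lra.
  rewrite sech_pow_sum_opp by lra. ring.
Qed.

Lemma sech_pow_sum_series (p : nat) (t : R) :
  0 < t -> sech_pow_sum (S p) t 0 = 1 + 2 * Series (fun n => sech (INR (S n) * t) ^ S p).
Proof.
  intros Ht. unfold sech_pow_sum.
  rewrite zsum_split_0 by now apply zsummable_sech_pow.
  rewrite Rmult_0_l, Rplus_0_l. replace (sech 0) with 1
    by (unfold sech; rewrite cosh_0; now rewrite Rinv_1).
  rewrite (Series_ext _ (fun n => sech (INR (S n) * t) ^ S p)).
  2:{ intros n. rewrite <- INR_IZR_INZ, Rplus_0_l. easy. }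
  rewrite (Series_ext (fun n => sech (0 + _) ^ S p) (fun n => sech (INR (S n) * t) ^ S p)).
  - rewrite pow1. ring.
  - intros n. rewrite <- sech_opp. do 2 f_equal.
    rewrite minus_IZR, <- INR_IZR_INZ, S_INR. ring.
Qed.

Lemma period_sum_series (t : R) :
  0 < t -> period_sum t = 1 + 2 * Series (fun n => sech (INR (S n) * t)).
Proof.
  intros Ht. unfold period_sum. rewrite sech_pow_sum_series by assumption.
  do 2 f_equal. apply Series_ext. intros n. apply pow_1.
Qed.

Lemma half_period_sum_pos (t : R) : 0 < t -> 0 < half_period_sum t.
Proof.
  intros Ht. unfold half_period_sum, sech_pow_sum.
  pose proof (zsummable_sech_pow 0 t (t / 2) Ht) as Hs.
  rewrite zsum_split_0 by assumption.
  destruct (zsummable_ex _ Hs) as [H1 H2].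
  apply ex_series_incr_1 in H1.
  pose proof (Series_nonneg _ (fun n => pow_le _ 1 (Rlt_le _ _ (proj1 (sech_bounds _)))) H1).
  pose proof (Series_nonneg _ (fun n => pow_le _ 1 (Rlt_le _ _ (proj1 (sech_bounds _)))) H2).
  cbv beta in *.
  pose proof (pow_lt _ 1 (proj1 (sech_bounds (t / 2 + 0 * t)))). lra.
Qed.

Lemma sech_decreasing (x y : R) : 0 <= x <= y -> sech y <= sech x.
Proof.
  intros H. unfold sech. apply Rinv_le_contravar.
  - pose proof (cosh_ge_1 x). lra.
  - pose proof (cosh_sq x). pose proof (cosh_sq y).
    pose proof (cosh_ge_1 x). pose proof (cosh_ge_1 y).
    assert (forall u v, u <= v -> sinh u <= sinh v) as Hm.
    { intros u v [Huv|Huv]; [left; now apply sinh_lt|rewrite Huv; lra]. }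
    pose proof (Hm 0 x (proj1 H)). pose proof (Hm x y (proj2 H)).
    rewrite sinh_0 in *. nra.
Qed.

(** The primitive of sech that vanishes at infinity. *)
Lemma is_derive_gudermann (x : R) : is_derive (fun x => -2 * atan (exp (- x))) x (sech x).
Proof.
  auto_derive; [easy|].
  unfold sech, cosh.
  assert (E : exp x = / exp (- x)) by (rewrite <- exp_Ropp; f_equal; ring).
  rewrite E. pose proof (exp_pos (- x)). unfold Rsqr.
  field. split; nra.
Qed.

(** The integral of sech over the half line is [PI / 2]; compare it with the
    left and right Riemann sums of mesh [t]. *)
Lemma period_sum_bounds (t : R) :
  0 < t -> PI / t - 1 <= period_sum t <= PI / t + 1.
Proof.
  intros Ht.
  set (w := fun n => -2 * atan (exp (- (INR n * t)))).
  assert (Hw : is_series (fun n => w (S n) - w n) (PI / 2)).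
  { replace (PI / 2) with (0 - w 0%nat).
    2:{ unfold w. simpl. rewrite Rmult_0_l, Ropp_0, exp_0, atan_1. field. }
    apply is_series_telescope. unfold w.
    replace (Finite 0) with (Rbar_mult (-2) (atan 0)) by (rewrite atan_0; simpl; f_equal; ring).
    apply is_lim_seq_scal_l.
    apply is_lim_seq_continuous.
    { apply derivable_continuous_pt, derivable_pt_atan. }
    apply is_lim_seq_ext with (fun n => exp (- t) ^ n).
    - intros n. rewrite <- exp_mult_nat. f_equal. ring.
    - apply is_lim_seq_geom. rewrite Rabs_pos_eq by (apply Rlt_le, exp_pos).
      rewrite <- exp_0. apply exp_increasing. lra. }
  assert (Hstep : forall n, sech (INR (S n) * t) * t <= w (S n) - w n <= sech (INR n * t) * t).
  { intros n. unfold w.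
    assert (Hn : INR n * t < INR (S n) * t) by (rewrite S_INR; nra).
    assert (Hn0 : 0 <= INR n * t) by (pose proof (pos_INR n); nra).
    destruct (MVT_gen (fun x => -2 * atan (exp (- x))) (INR n * t) (INR (S n) * t) sech)
      as [c [Hc ->]].
    - intros x _. apply is_derive_gudermann.
    - intros x _. apply continuity_pt_filterlim.
      apply (ex_derive_continuous (fun x => -2 * atan (exp (- x)))).
      exists (sech x). apply is_derive_gudermann.
    - rewrite Rmin_left, Rmax_right in Hc by lra.
      replace (INR (S n) * t - INR n * t) with t by (rewrite S_INR; ring).
      split; apply Rmult_le_compat_r; try lra; apply sech_decreasing; lra. }
  assert (Hs : ex_series (fun n => sech (INR n * t))).
  { apply ex_series_ext with (2 := ex_series_sech_progression 0 t Ht).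
    intros n. now rewrite Rplus_0_l. }
  assert (Hs1 : ex_series (fun n => sech (INR (S n) * t))).
  { exact (proj1 (ex_series_incr_1 (fun n => sech (INR n * t))) Hs). }
  rewrite period_sum_series by assumption.
  assert (Hex : ex_series (fun n => w (S n) - w n)) by now exists (PI / 2).
  apply is_series_unique in Hw.
  assert (L : Series (fun n => sech (INR (S n) * t) * t) <= PI / 2).
  { rewrite <- Hw. apply Series_le; [|exact Hex]. intros n. split; [|apply Hstep].
    pose proof (sech_bounds (INR (S n) * t)). nra. }
  assert (U : PI / 2 <= Series (fun n => sech (INR n * t) * t)).
  { rewrite <- Hw. apply Series_le; [|now apply ex_series_scal_r]. intros n.
    split; [|apply Hstep]. apply Rle_trans with (2 := proj1 (Hstep n)).
    pose proof (sech_bounds (INR (S n) * t)). nra. }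
  rewrite Series_scal_r in L, U. rewrite (Series_incr_1 _ Hs) in U.
  simpl (INR 0) in U. rewrite Rmult_0_l in U.
  replace (sech 0) with 1 in U by (unfold sech; rewrite cosh_0; now rewrite Rinv_1).
  set (S1 := Series (fun n => sech (INR (S n) * t))) in *.
  assert (E : PI / t * t = PI) by (field; lra).
  split; apply Rmult_le_reg_r with t; try assumption; nra.
Qed.

Lemma period_sum_ge_1 (t : R) : 0 < t -> 1 <= period_sum t.
Proof.
  intros Ht. rewrite period_sum_series by assumption.
  enough (0 <= Series (fun n => sech (INR (S n) * t))) by lra.
  apply Series_nonneg; [intros; apply Rlt_le, sech_bounds|].
  apply ex_series_ext with (2 := ex_series_sech_progression t t Ht).
  intros n. f_equal. rewrite S_INR. ring.
Qed.

Lemma half_period_sum_bounds (t : R) :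
  0 < t -> PI / t - 2 <= half_period_sum t <= 2 * PI / t.
Proof.
  intros Ht. assert (Ht2 : 0 < t / 2) by lra.
  pose proof (period_sum_duplication (t / 2) Ht2) as E.
  replace (2 * (t / 2)) with t in E by field.
  pose proof (period_sum_bounds _ Ht). pose proof (period_sum_bounds _ Ht2).
  pose proof (period_sum_ge_1 _ Ht).
  replace (PI / (t / 2)) with (2 * (PI / t)) in * by (field; lra).
  replace (2 * PI / t) with (2 * (PI / t)) by (field; lra). lra.
Qed.

(** * The Lambert series *)

Lemma ex_series_odd_squares (r : R) :
  0 < r < 1 -> ex_series (fun n => (2 * INR n + 1) ^ 2 * r ^ n).
Proof.
  intros Hr.
  assert (Hp : forall n, 0 < (2 * INR n + 1) ^ 2 * r ^ n).
  { intros n. apply Rmult_lt_0_compat; apply pow_lt; [|lra]. pose proof (pos_INR n). lra. }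
  apply ex_series_Rabs.
  apply ex_series_DAlembert with r; [lra|intros n; specialize (Hp n); lra|].
  apply is_lim_seq_ext with
    (fun n => (1 + / (INR n + / 2)) * (1 + / (INR n + / 2)) * r).
  - intros n. pose proof (pos_INR n). rewrite Rabs_pos_eq.
    + rewrite S_INR. simpl pow. field. pose proof (pow_lt r n (proj1 Hr)). lra.
    + apply Rlt_le, Rdiv_lt_0_compat; apply Hp.
  - assert (H1 : is_lim_seq (fun n => 1 + / (INR n + / 2)) 1).
    { replace (Finite 1) with (Finite (1 + 0)) by (f_equal; ring).
      apply is_lim_seq_plus'; [apply is_lim_seq_const|].
      apply (is_lim_seq_inv _ p_infty); [|easy].
      eapply is_lim_seq_plus; [apply is_lim_seq_INR|apply is_lim_seq_const|easy]. }
    replace (Finite r) with (Finite (1 * 1 * r)) by (f_equal; ring).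
    apply is_lim_seq_mult'; [|apply is_lim_seq_const].
    now apply is_lim_seq_mult'.
Qed.

Lemma ex_series_odd_squares_abs (w : R) :
  Rabs w < 1 -> ex_series (fun n => Rabs ((2 * INR n + 1) ^ 2 * w ^ n)).
Proof.
  intros Hw. pose proof (Rabs_pos w).
  apply ex_series_le_abs with (fun n => (2 * INR n + 1) ^ 2 * ((Rabs w + 1) / 2) ^ n).
  - intros n. rewrite Rabs_Rabsolu, Rabs_mult, <- (RPow_abs w n).
    rewrite (Rabs_pos_eq (_ ^ 2)) by apply pow2_ge_0.
    apply Rmult_le_compat_l; [apply pow2_ge_0|]. apply pow_incr. lra.
  - apply ex_series_odd_squares. lra.
Qed.

Lemma Series_odd_squares (w : R) :
  Rabs w < 1 ->
  Series (fun n => (2 * INR n + 1) ^ 2 * w ^ n) = (1 + 6 * w + w ^ 2) / (1 - w) ^ 3.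
Proof.
  intros Hw.
  assert (Hw1 : 1 - w <> 0) by (pose proof (Rle_abs w); lra).
  assert (EA : ex_series (fun n => (2 * INR n + 1) ^ 2 * w ^ n))
    by now apply ex_series_Rabs, ex_series_odd_squares_abs.
  assert (EG : ex_series (fun n => w ^ n)) by now apply ex_series_geom.
  assert (EB : ex_series (fun n => (INR n + 1) * w ^ n)).
  { apply ex_series_le_abs with (2 := ex_series_odd_squares_abs w Hw). intros n.
    rewrite !Rabs_mult. apply Rmult_le_compat_r; [apply Rabs_pos|].
    pose proof (pos_INR n). rewrite !Rabs_pos_eq by nra. nra. }
  set (A := Series (fun n => (2 * INR n + 1) ^ 2 * w ^ n)) in *.
  set (B := Series (fun n => (INR n + 1) * w ^ n)).
  (* Removing the first term turns each sum into [w] times itself plus a sum of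
     lower degree in the index. *)
  assert (B1 : B = 1 + w * (B + / (1 - w))).
  { unfold B at 1. rewrite Series_incr_1 by assumption.
    rewrite (Series_ext _ (fun n => w * (1 * ((INR n + 1) * w ^ n) + 1 * w ^ n)))
      by (intros n; rewrite S_INR; simpl; ring).
    rewrite Series_scal_l, Series_comb, Series_geom by assumption.
    fold B. simpl. ring. }
  assert (A1 : A = 1 + w * (A + 8 * B)).
  { unfold A at 1. rewrite Series_incr_1 by assumption.
    rewrite (Series_ext _ (fun n => w * (1 * ((2 * INR n + 1) ^ 2 * w ^ n)
                                         + 8 * ((INR n + 1) * w ^ n))))
      by (intros n; rewrite S_INR; simpl; ring).
    rewrite Series_scal_l, Series_comb by assumption.
    fold A B. simpl. ring. }
  assert (B2 : B = / (1 - w) ^ 2).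
  { apply Rmult_eq_reg_r with (1 - w); [|exact Hw1].
    transitivity (1 + w * / (1 - w)); [lra|]. field. exact Hw1. }
  apply Rmult_eq_reg_r with (1 - w); [|exact Hw1].
  transitivity (1 + 8 * w * B); [lra|]. rewrite B2. field. exact Hw1.
Qed.

Lemma sech_exp (x : R) : sech x = 2 * exp (- x) / (1 + exp (- x) ^ 2).
Proof.
  unfold sech, cosh.
  assert (E : exp x = / exp (- x)) by (rewrite <- exp_Ropp; f_equal; ring).
  rewrite E. pose proof (exp_pos (- x)). field. split; nra.
Qed.

(** The right-hand side is [sech'' / 2], and the left-hand side is the termwise
    second derivative of the geometric expansion of [sech / 2] in powers of
    [exp (- x)]. *)
Lemma sech_second_derivative_expansion (x : R) :
  0 < x ->
  Series (fun n => (-1) ^ n * (2 * INR n + 1) ^ 2 * exp (- x) ^ (2 * n + 1))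
  = (sech x - 2 * sech x ^ 3) / 2.
Proof.
  intros Hx. set (z := exp (- x)).
  assert (Hz : 0 < z < 1).
  { split; [apply exp_pos|]. unfold z. rewrite <- exp_0. apply exp_increasing. lra. }
  rewrite (Series_ext _ (fun n => z * ((2 * INR n + 1) ^ 2 * (- z ^ 2) ^ n))).
  - rewrite Series_scal_l, Series_odd_squares.
    + rewrite sech_exp. fold z. field. nra.
    + rewrite Rabs_Ropp, Rabs_pos_eq; nra.
  - intros n. replace (- z ^ 2) with (-1 * z ^ 2) by ring.
    rewrite Rpow_mult_distr, pow_add, pow_mult. ring.
Qed.

Lemma Series_abs_odd_squares_le (z r : R) :
  0 < z <= r -> r < 1 ->
  ex_series (fun n => Rabs ((-1) ^ n * (2 * INR n + 1) ^ 2 * z ^ (2 * n + 1))) /\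
  Series (fun n => Rabs ((-1) ^ n * (2 * INR n + 1) ^ 2 * z ^ (2 * n + 1)))
  <= 8 / (1 - r ^ 2) ^ 3 * z.
Proof.
  intros Hz Hr.
  assert (Hz2 : Rabs (z ^ 2) < 1) by (rewrite Rabs_pos_eq; nra).
  assert (E : forall n, z * ((2 * INR n + 1) ^ 2 * (z ^ 2) ^ n)
     = Rabs ((-1) ^ n * (2 * INR n + 1) ^ 2 * z ^ (2 * n + 1))).
  { intros n. rewrite !Rabs_mult, pow_1_abs, Rmult_1_l.
    rewrite !Rabs_pos_eq by (try apply pow2_ge_0; apply pow_le; lra).
    rewrite pow_add, pow_mult. ring. }
  split.
  - apply ex_series_ext with (1 := E).
    apply (ex_series_scal_l z (fun n => (2 * INR n + 1) ^ 2 * (z ^ 2) ^ n)).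
    now apply ex_series_Rabs, ex_series_odd_squares_abs.
  - rewrite <- (Series_ext _ _ E), Series_scal_l, Series_odd_squares by assumption.
    rewrite Rmult_comm. apply Rmult_le_compat_r; [lra|].
    assert (0 < 1 - r ^ 2 <= 1 - z ^ 2) by nra.
    unfold Rdiv. apply Rmult_le_compat.
    + nra.
    + apply Rlt_le, Rinv_0_lt_compat, pow_lt. lra.
    + assert (z ^ 2 <= 1) by nra. nra.
    + apply Rinv_le_contravar; [apply pow_lt; lra|]. apply pow_incr. lra.
Qed.

(** Expand each term with [m <> 0] in powers of [exp (- |m| t)] and sum over [m]
    first. *)
Lemma lambert_series (t : R) :
  0 < t ->
  2 * sech_pow_sum 3 t 0 - sech_pow_sum 1 t 0
  = 1 - 4 * Series (fun n => (-1) ^ n * (2 * INR n + 1) ^ 2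
                             / (exp ((2 * INR n + 1) * t) - 1)).
Proof.
  intros Ht.
  assert (Hs : forall p, ex_series (fun n => sech (INR (S n) * t) ^ S p)).
  { intros p. apply ex_series_le_abs with (2 := ex_series_sech_progression t t Ht).
    intros n. rewrite S_INR. replace ((INR n + 1) * t) with (t + INR n * t) by ring.
    pose proof (sech_bounds (t + INR n * t)).
    pose proof (sech_power_le_1 (t + INR n * t) p).
    simpl. rewrite Rabs_mult, (Rabs_pos_eq (sech _)) by lra.
    pose proof (Rabs_pos (sech (t + INR n * t) ^ p)). nra. }
  set (F := fun m n : nat => (-1) ^ n * (2 * INR n + 1) ^ 2
                             * exp (- (INR (S m) * t)) ^ (2 * n + 1)).
  assert (Hr : exp (- t) < 1) by (rewrite <- exp_0; apply exp_increasing; lra).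
  assert (Hz : forall m, 0 < exp (- (INR (S m) * t)) <= exp (- t)).
  { intros m. split; [apply exp_pos|]. rewrite S_INR. pose proof (pos_INR m).
    destruct (Rle_lt_or_eq_dec 0 (INR m) (pos_INR m)) as [H'|H'].
    - left. apply exp_increasing. nra.
    - right. f_equal. rewrite <- H'. ring. }
  destruct (fubini F) as (_ & _ & E).
  - intros m. apply (Series_abs_odd_squares_le _ _ (Hz m) Hr).
  - apply ex_series_le_abs with
      (fun m => 8 / (1 - exp (- t) ^ 2) ^ 3 * (exp (- t) * exp (- t) ^ m)).
    + intros m. destruct (Series_abs_odd_squares_le _ _ (Hz m) Hr) as [H1 H2].
      rewrite Rabs_pos_eq by (apply Series_nonneg; [intros; apply Rabs_pos|exact H1]).
      apply Rle_trans with (1 := H2). right. f_equal.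
      rewrite <- exp_mult_nat, <- exp_plus, S_INR. f_equal. ring.
    + apply (ex_series_scal_l (8 / (1 - exp (- t) ^ 2) ^ 3)
               (fun m => exp (- t) * exp (- t) ^ m)).
      apply (ex_series_scal_l (exp (- t)) (pow (exp (- t)))), ex_series_geom.
      rewrite Rabs_pos_eq; [exact Hr|apply Rlt_le, exp_pos].
  - rewrite (Series_ext (fun m => Series (F m))
       (fun m => (1 / 2) * sech (INR (S m) * t) ^ 1 + -1 * sech (INR (S m) * t) ^ 3)) in E.
    2:{ intros m. unfold F. rewrite sech_second_derivative_expansion.
        - field.
        - apply Rmult_lt_0_compat; [apply lt_0_INR; lia|exact Ht]. }
    rewrite Series_comb in E by apply Hs.
    rewrite (Series_ext _ (fun n => Series (fun m => F m n))).
    + rewrite E, !sech_pow_sum_series by assumption. field.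
    + intros n. unfold F. set (s := (2 * INR n + 1) * t).
      assert (Hsp : 0 < s) by (apply Rmult_lt_0_compat; [pose proof (pos_INR n); lra|exact Ht]).
      assert (Hq : exp (- s) < 1) by (rewrite <- exp_0; apply exp_increasing; lra).
      rewrite (Series_ext _ (fun m => (-1) ^ n * (2 * INR n + 1) ^ 2 * exp (- s)
                                      * exp (- s) ^ m)).
      * rewrite Series_scal_l, Series_geom
          by (rewrite Rabs_pos_eq; [exact Hq|apply Rlt_le, exp_pos]).
        assert (Ei : exp s = / exp (- s)) by (rewrite <- exp_Ropp; f_equal; ring).
        rewrite Ei. pose proof (exp_pos (- s)). field. split; lra.
      * intros m. rewrite <- !exp_mult_nat, (Rmult_assoc _ (exp _) (exp _)), <- exp_plus. do 2 f_equal.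
        unfold s. rewrite plus_INR, mult_INR, (S_INR m). simpl (INR 2). simpl (INR 1). ring.
Qed.

(** * Gauss's transformation of the elliptic integral *)

Definition gauss_integrand (a b x : R) : R :=
  / sqrt (a ^ 2 * cos x ^ 2 + b ^ 2 * sin x ^ 2).

Definition gauss_integral (a b : R) : R := RInt (gauss_integrand a b) 0 (PI / 2).

Lemma cos_sq (x : R) : cos x ^ 2 = 1 - sin x ^ 2.
Proof. pose proof (sin2_cos2 x) as H. unfold Rsqr in H. lra. Qed.

Lemma gauss_radicand_pos (a b x : R) :
  0 < a -> 0 < b -> 0 < a ^ 2 * cos x ^ 2 + b ^ 2 * sin x ^ 2.
Proof.
  intros Ha Hb. pose proof (cos_sq x).
  pose proof (pow2_ge_0 (sin x)). pose proof (pow2_ge_0 (cos x)).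
  assert (0 < a ^ 2) by (apply pow_lt; lra). assert (0 < b ^ 2) by (apply pow_lt; lra).
  destruct (Rle_lt_dec (sin x ^ 2) (1 / 2)); nra.
Qed.

Lemma continuous_gauss_integrand (a b x : R) :
  0 < a -> 0 < b -> continuous (gauss_integrand a b) x.
Proof.
  intros Ha Hb. pose proof (gauss_radicand_pos a b x Ha Hb) as Hp.
  apply (ex_derive_continuous (gauss_integrand a b)). unfold gauss_integrand.
  auto_derive. split; [|split; [|easy]].
  - simpl in *. lra.
  - apply Rgt_not_eq, sqrt_lt_R0. simpl in *. lra.
Qed.

Lemma ex_RInt_gauss (a b u v : R) :
  0 < a -> 0 < b -> ex_RInt (gauss_integrand a b) u v.
Proof.
  intros Ha Hb. apply (ex_RInt_continuous (gauss_integrand a b)).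
  intros; now apply continuous_gauss_integrand.
Qed.

Lemma gauss_integral_bounds (a b : R) :
  0 < b -> b <= a ->
  PI / 2 <= gauss_integral a b * a /\ gauss_integral a b * b <= PI / 2.
Proof.
  intros Hb Hab. assert (Ha : 0 < a) by lra.
  pose proof PI_RGT_0.
  assert (Hx : forall x, / a <= gauss_integrand a b x <= / b).
  { intros x. unfold gauss_integrand.
    pose proof (gauss_radicand_pos a b x Ha Hb).
    pose proof (cos_sq x). pose proof (pow2_ge_0 (sin x)). pose proof (pow2_ge_0 (cos x)).
    assert (b ^ 2 <= a ^ 2) by (apply pow_incr; lra).
    split; apply Rinv_le_contravar; try lra.
    - apply sqrt_lt_R0. lra.
    - apply Rle_trans with (sqrt (a ^ 2)); [apply sqrt_le_1; nra|rewrite sqrt_pow2; lra].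
    - apply Rle_trans with (sqrt (b ^ 2)); [rewrite sqrt_pow2; lra|apply sqrt_le_1; nra]. }
  assert (Hc : forall c, RInt (fun _ => c) 0 (PI / 2) = PI / 2 * c).
  { intros c. rewrite RInt_const. unfold scal; simpl. unfold mult; simpl. lra. }
  assert (L : PI / 2 * / a <= gauss_integral a b).
  { rewrite <- Hc. apply RInt_le; [lra|apply ex_RInt_const|now apply ex_RInt_gauss|].
    intros x _. apply Hx. }
  assert (U : gauss_integral a b <= PI / 2 * / b).
  { rewrite <- Hc. apply RInt_le; [lra|now apply ex_RInt_gauss|apply ex_RInt_const|].
    intros x _. apply Hx. }
  split.
  - apply Rmult_le_compat_r with (r := a) in L; [|lra].
    rewrite Rmult_assoc, Rinv_l in L by lra. lra.
  - apply Rmult_le_compat_r with (r := b) in U; [|lra].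
    rewrite Rmult_assoc, Rinv_l in U by lra. lra.
Qed.

Lemma gauss_integral_scale (l a b : R) :
  0 < l -> 0 < a -> 0 < b -> l * gauss_integral (l * a) (l * b) = gauss_integral a b.
Proof.
  intros Hl Ha Hb. unfold gauss_integral.
  assert (Hex : ex_RInt (gauss_integrand (l * a) (l * b)) 0 (PI / 2))
    by (apply ex_RInt_gauss; now apply Rmult_lt_0_compat).
  pose proof (RInt_scal _ 0 (PI / 2) l Hex) as E. unfold scal in E; simpl in E.
  unfold mult in E; simpl in E. rewrite <- E.
  apply RInt_ext. intros x _. unfold gauss_integrand.
  pose proof (gauss_radicand_pos a b x Ha Hb).
  replace ((l * a) ^ 2 * cos x ^ 2 + (l * b) ^ 2 * sin x ^ 2)
    with (l ^ 2 * (a ^ 2 * cos x ^ 2 + b ^ 2 * sin x ^ 2)) by ring.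
  rewrite sqrt_mult, sqrt_pow2 by nra.
  assert (0 < sqrt (a ^ 2 * cos x ^ 2 + b ^ 2 * sin x ^ 2)) by now apply sqrt_lt_R0.
  match goal with |- ?u = ?v => change (@eq R u v) end. field. lra.
Qed.

Lemma RInt_gauss_0_PI (a b : R) :
  0 < a -> 0 < b -> RInt (gauss_integrand a b) 0 PI = 2 * gauss_integral a b.
Proof.
  intros Ha Hb.
  rewrite <- (RInt_Chasles _ 0 (PI / 2) PI) by now apply ex_RInt_gauss.
  assert (E : RInt (gauss_integrand a b) (PI / 2) PI = gauss_integral a b).
  { pose proof (RInt_comp_lin (gauss_integrand a b) (-1) PI 0 (PI / 2)) as E.
    replace (-1 * 0 + PI) with PI in E by ring.
    replace (-1 * (PI / 2) + PI) with (PI / 2) in E by field.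
    specialize (E (ex_RInt_gauss a b _ _ Ha Hb)).
    rewrite <- opp_RInt_swap by now apply ex_RInt_gauss.
    rewrite <- E.
    transitivity (opp (RInt (fun x => scal (-1) (gauss_integrand a b x)) 0 (PI / 2))).
    - apply f_equal, RInt_ext. intros x _. apply f_equal. unfold gauss_integrand.
      replace (-1 * x + PI) with (PI - x) by ring.
      rewrite cos_minus, sin_minus, cos_PI, sin_PI. do 2 f_equal. ring.
    - pose proof (RInt_scal (gauss_integrand a b) 0 (PI / 2) (-1)
                    (ex_RInt_gauss a b 0 (PI / 2) Ha Hb)) as E2.
      apply (eq_trans (f_equal opp E2)).
      unfold scal, opp, gauss_integral; simpl. unfold mult; simpl.
      match goal with |- ?u = ?v => change (@eq R u v) end. ring. }
  rewrite E. unfold plus; simpl. unfold gauss_integral. ring.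
Qed.

(** For [tan (theta) = (b / a) tan (x)], this is the angle [x + theta], written
    so as to be smooth across the poles of the tangent. *)
Definition landen_angle (a b x : R) : R :=
  2 * x - atan ((a - b) * sin x * cos x / (a * cos x ^ 2 + b * sin x ^ 2)).

Lemma landen_denominator_pos (a b x : R) :
  0 < a -> 0 < b -> 0 < a * cos x ^ 2 + b * sin x ^ 2.
Proof.
  intros Ha Hb. pose proof (cos_sq x).
  pose proof (pow2_ge_0 (sin x)). pose proof (pow2_ge_0 (cos x)).
  destruct (Rle_lt_dec (sin x ^ 2) (1 / 2)); nra.
Qed.

Lemma is_derive_landen_angle (a b x : R) :
  0 < a -> 0 < b ->
  is_derive (landen_angle a b) x
    ((a + b) * (a * cos x ^ 2 + b * sin x ^ 2) / (a ^ 2 * cos x ^ 2 + b ^ 2 * sin x ^ 2)).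
Proof.
  intros Ha Hb.
  pose proof (landen_denominator_pos a b x Ha Hb) as HN.
  pose proof (gauss_radicand_pos a b x Ha Hb) as HD.
  pose proof (cos_sq x) as E.
  unfold landen_angle. auto_derive.
  - simpl in HN. lra.
  - simpl in HN, HD. unfold Rsqr. rewrite !Rmult_1_r in *.
    set (N := a * (cos x * cos x) + b * (sin x * sin x)) in *.
    assert (Eu : 1 + (a - b) * sin x * cos x * / N * ((a - b) * sin x * cos x * / N)
                 = (a * a * (cos x * cos x) + b * b * (sin x * sin x)) / (N * N)).
    { field_simplify_eq; [|lra]. unfold N. simpl in E. ring [E]. }
    simpl. rewrite !Rmult_1_r. fold N. rewrite Eu. field_simplify_eq; [|split; lra].
    unfold N. ring [E].
Qed.

Lemma landen_radicand (a b x : R) :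
  0 < a -> 0 < b ->
  ((a + b) / 2) ^ 2 * cos (landen_angle a b x) ^ 2
    + (a * b) * sin (landen_angle a b x) ^ 2
  = ((a + b) / 2) ^ 2 * (a * cos x ^ 2 + b * sin x ^ 2) ^ 2
      / (a ^ 2 * cos x ^ 2 + b ^ 2 * sin x ^ 2).
Proof.
  intros Ha Hb.
  pose proof (landen_denominator_pos a b x Ha Hb) as HN.
  pose proof (gauss_radicand_pos a b x Ha Hb) as HD.
  pose proof (cos_sq x) as E.
  unfold landen_angle.
  set (N := a * cos x ^ 2 + b * sin x ^ 2) in *.
  set (D := a ^ 2 * cos x ^ 2 + b ^ 2 * sin x ^ 2) in *.
  set (u := (a - b) * sin x * cos x / N).
  assert (Eu : 1 + u * u = D / N ^ 2).
  { unfold u. field_simplify_eq; [|lra]. unfold N, D. rewrite E. ring. }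
  assert (Hr : sqrt (1 + u²) ^ 2 = D / N ^ 2).
  { rewrite pow2_sqrt; unfold Rsqr; [exact Eu|nra]. }
  assert (Hr0 : sqrt (1 + u²) <> 0).
  { apply Rgt_not_eq, sqrt_lt_R0. unfold Rsqr. nra. }
  rewrite cos_minus, sin_minus, cos_atan, sin_atan, sin_2a, cos_2a.
  set (r := sqrt (1 + u²)) in *.
  replace (cos x * cos x - sin x * sin x) with (1 - 2 * sin x ^ 2) by (rewrite <- (Rplus_0_r 1); nra).
  assert (Ec : (1 - 2 * sin x ^ 2) * (1 / r) + 2 * sin x * cos x * (u / r)
               = (a * cos x ^ 2 - b * sin x ^ 2) / (N * r)).
  { unfold u. field_simplify_eq; [|split; [exact Hr0|lra]]. unfold N.
    rewrite E. ring. }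
  assert (Es : 2 * sin x * cos x * (1 / r) - (1 - 2 * sin x ^ 2) * (u / r)
               = (a + b) * sin x * cos x / (N * r)).
  { unfold u. field_simplify_eq; [|split; [exact Hr0|lra]]. unfold N.
    rewrite E. ring. }
  rewrite Ec, Es.
  replace (((a + b) / 2) ^ 2 * ((a * cos x ^ 2 - b * sin x ^ 2) / (N * r)) ^ 2 +
     a * b * ((a + b) * sin x * cos x / (N * r)) ^ 2)
   with (((a + b) / 2) ^ 2 * ((a * cos x ^ 2 - b * sin x ^ 2) ^ 2
          + 4 * a * b * sin x ^ 2 * cos x ^ 2) / (N ^ 2 * r ^ 2))
   by (field; split; [exact Hr0|lra]).
  rewrite Hr. unfold N. field. fold N D. lra.
Qed.

(** Pulling the integral over [[0, PI]] back along the angle [x + theta] doubles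
    the integrand of the original pair. *)
Lemma gauss_integral_agm (a b : R) :
  0 < a -> 0 < b -> gauss_integral ((a + b) / 2) (sqrt (a * b)) = gauss_integral a b.
Proof.
  intros Ha Hb.
  assert (Ha1 : 0 < (a + b) / 2) by lra.
  assert (Hab : 0 < a * b) by now apply Rmult_lt_0_compat.
  assert (Hb1 : 0 < sqrt (a * b)) by now apply sqrt_lt_R0.
  set (dg := fun x => (a + b) * (a * cos x ^ 2 + b * sin x ^ 2)
                      / (a ^ 2 * cos x ^ 2 + b ^ 2 * sin x ^ 2)).
  pose proof (RInt_comp (gauss_integrand ((a + b) / 2) (sqrt (a * b)))
                (landen_angle a b) dg 0 (PI / 2)) as E.
  assert (E0 : landen_angle a b 0 = 0).
  { unfold landen_angle. rewrite sin_0, cos_0.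
    replace ((a - b) * 0 * 1 / _) with 0 by (field; lra). rewrite atan_0. ring. }
  assert (E1 : landen_angle a b (PI / 2) = PI).
  { unfold landen_angle. rewrite sin_PI2, cos_PI2.
    replace ((a - b) * 1 * 0 / _) with 0 by (field; lra). rewrite atan_0. field. }
  rewrite E0, E1, RInt_gauss_0_PI in E by assumption.
  assert (Hpull : forall x,
    dg x * gauss_integrand ((a + b) / 2) (sqrt (a * b)) (landen_angle a b x)
    = 2 * gauss_integrand a b x).
  { intros x.
    pose proof (landen_denominator_pos a b x Ha Hb) as HN.
    pose proof (gauss_radicand_pos a b x Ha Hb) as HD.
    unfold gauss_integrand, dg. rewrite (pow2_sqrt (a * b)), landen_radicand by lra.
    set (N := a * cos x ^ 2 + b * sin x ^ 2) in *.
    set (D := a ^ 2 * cos x ^ 2 + b ^ 2 * sin x ^ 2) in *.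
    assert (HsD : 0 < sqrt D) by now apply sqrt_lt_R0.
    rewrite sqrt_div_alt by exact HD.
    replace (((a + b) / 2) ^ 2 * N ^ 2) with (((a + b) / 2 * N) ^ 2) by ring.
    rewrite sqrt_pow2 by nra.
    rewrite <- (sqrt_sqrt D) at 1 by lra.
    field. lra. }
  apply Rmult_eq_reg_l with 2; [|lra].
  rewrite <- E.
  - pose proof (RInt_scal _ 0 (PI / 2) 2 (ex_RInt_gauss a b 0 (PI / 2) Ha Hb)) as E2.
    unfold gauss_integral. apply eq_trans with (2 := E2).
    apply RInt_ext. intros x _. apply Hpull.
  - intros x _. now apply continuous_gauss_integrand.
  - intros x _. split; [now apply is_derive_landen_angle|].
    pose proof (gauss_radicand_pos a b x Ha Hb) as HD.
    apply (ex_derive_continuous dg). unfold dg. auto_derive. simpl in HD. lra.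
Qed.

(** * Evaluating the elliptic integrals at the sums *)

Lemma le_of_geometric_error (x y c : R) :
  (forall n : nat, x <= y + c * (1 / 2) ^ n) -> x <= y.
Proof.
  intros H.
  assert (L : is_lim_seq (fun n => y + c * (1 / 2) ^ n) (y + c * 0)).
  { apply is_lim_seq_plus'; [apply is_lim_seq_const|].
    apply (is_lim_seq_scal_l _ c 0). apply is_lim_seq_geom.
    rewrite Rabs_pos_eq; lra. }
  pose proof (is_lim_seq_le _ _ x _ H (is_lim_seq_const x) L) as H'.
  simpl in H'. lra.
Qed.

Lemma pow_half_inv (n : nat) : (1 / 2) ^ n = / 2 ^ n.
Proof. rewrite <- pow_inv. f_equal. field. Qed.

Lemma period_sums_sq_diff (t : R) :
  0 < t ->
  period_sum t ^ 2 - half_period_sum t ^ 2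
  = (period_sum (2 * t) - half_period_sum (2 * t)) ^ 2.
Proof.
  intros Ht. rewrite half_period_sum_duplication, period_sum_duplication by assumption.
  ring.
Qed.

(** Equality would propagate from [t] to [2 t], but for large arguments the two
    sums are close to [1] and [0]. *)
Lemma half_period_sum_lt (t : R) : 0 < t -> half_period_sum t < period_sum t.
Proof.
  intros Ht. apply Rnot_le_lt. intros H.
  assert (Hn : forall n : nat, period_sum (2 ^ n * t) <= half_period_sum (2 ^ n * t)).
  { induction n as [|n IH].
    - simpl. now rewrite Rmult_1_l.
    - assert (Hs : 0 < 2 ^ n * t) by (apply Rmult_lt_0_compat; [apply pow_lt|]; lra).
      pose proof (period_sums_sq_diff _ Hs) as E.
      replace (2 ^ S n * t) with (2 * (2 ^ n * t)) by (simpl; ring).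
      pose proof (period_sum_ge_1 _ Hs). nra. }
  assert (1 <= 0); [|lra].
  apply le_of_geometric_error with (2 * PI / t). intros n.
  assert (H2 : 0 < 2 ^ n) by (apply pow_lt; lra).
  assert (Hs : 0 < 2 ^ n * t) by now apply Rmult_lt_0_compat.
  pose proof (period_sum_ge_1 _ Hs). pose proof (half_period_sum_bounds _ Hs).
  specialize (Hn n).
  rewrite pow_half_inv.
  replace (2 * PI / (2 ^ n * t)) with (2 * PI / t * / 2 ^ n) in * by (field; lra). lra.
Qed.

(** This is [sqrt (a ^ 2 - b ^ 2)] for the sums [a], [b] at [t], in a form that makes
    its step of the arithmetic-geometric mean visible. *)
Definition complementary_sum (t : R) : R := period_sum (2 * t) - half_period_sum (2 * t).

Lemma complementary_sum_pos (t : R) : 0 < t -> 0 < complementary_sum t.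
Proof.
  intros Ht. unfold complementary_sum. pose proof (half_period_sum_lt (2 * t)). lra.
Qed.

Lemma complementary_sum_sq (t : R) :
  0 < t -> complementary_sum t ^ 2 = period_sum t ^ 2 - half_period_sum t ^ 2.
Proof. intros Ht. now rewrite period_sums_sq_diff. Qed.

Lemma gauss_integral_complementary_step (t : R) :
  0 < t ->
  gauss_integral (period_sum (2 * t)) (complementary_sum (2 * t))
  = gauss_integral (period_sum t) (complementary_sum t).
Proof.
  intros Ht. assert (Ht2 : 0 < 2 * t) by lra.
  pose proof (period_sum_ge_1 _ Ht). pose proof (complementary_sum_pos _ Ht).
  rewrite <- (gauss_integral_agm (period_sum t)) by lra.
  f_equal.
  - rewrite (period_sum_duplication t) by assumption. unfold complementary_sum. field.
  - rewrite <- (sqrt_pow2 (complementary_sum (2 * t)))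
      by (apply Rlt_le, complementary_sum_pos; lra).
    f_equal. rewrite complementary_sum_sq by assumption.
    rewrite (period_sum_duplication t) by assumption. unfold complementary_sum. ring.
Qed.

(** Doubling [t] leaves the integral unchanged and drives both arguments to [1]. *)
Lemma gauss_integral_complementary (t : R) :
  0 < t -> gauss_integral (period_sum t) (complementary_sum t) = PI / 2.
Proof.
  intros Ht. set (J := gauss_integral (period_sum t) (complementary_sum t)).
  assert (Hn : forall n : nat,
     gauss_integral (period_sum (2 ^ n * t)) (complementary_sum (2 ^ n * t)) = J).
  { induction n as [|n IH].
    - simpl. now rewrite Rmult_1_l.
    - replace (2 ^ S n * t) with (2 * (2 ^ n * t)) by (simpl; ring).
      rewrite gauss_integral_complementary_step; [exact IH|].
      apply Rmult_lt_0_compat; [apply pow_lt|]; lra. }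
  assert (Hb : forall n : nat,
     PI / 2 <= J * (1 + PI / t * (1 / 2) ^ n) /\
     J * (1 - 2 * PI / t * (1 / 2) ^ n) <= PI / 2 /\ 0 <= J).
  { intros n.
    assert (H2 : 0 < 2 ^ n) by (apply pow_lt; lra).
    assert (Hs : 0 < 2 ^ n * t) by now apply Rmult_lt_0_compat.
    pose proof (period_sum_ge_1 _ Hs) as A1. pose proof (period_sum_bounds _ Hs) as A2.
    pose proof (half_period_sum_bounds _ Hs) as B1. pose proof (half_period_sum_pos _ Hs).
    pose proof (complementary_sum_pos _ Hs) as C1.
    pose proof (complementary_sum_sq _ Hs) as C2.
    destruct (gauss_integral_bounds (period_sum (2 ^ n * t)) (complementary_sum (2 ^ n * t)))
      as [L U]; [exact C1|nra|].
    rewrite (Hn n) in L, U.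
    rewrite pow_half_inv.
    replace (PI / t * / 2 ^ n) with (PI / (2 ^ n * t)) by (field; lra).
    replace (2 * PI / t * / 2 ^ n) with (2 * PI / (2 ^ n * t)) by (field; lra).
    pose proof PI_RGT_0.
    assert (HJ : 0 <= J) by nra.
    assert (period_sum (2 ^ n * t) - half_period_sum (2 ^ n * t)
            <= complementary_sum (2 ^ n * t)) by nra.
    repeat split; [nra|nra|exact HJ]. }
  apply Rle_antisym.
  - apply le_of_geometric_error with (J * (2 * PI / t)). intros n.
    specialize (Hb n). lra.
  - apply le_of_geometric_error with (J * (PI / t)). intros n.
    specialize (Hb n). lra.
Qed.

Lemma gauss_integral_half_period_step (t : R) :
  0 < t ->
  gauss_integral (period_sum (2 * t)) (half_period_sum (2 * t))
  = 2 * gauss_integral (period_sum t) (half_period_sum t).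
Proof.
  intros Ht. assert (Ht2 : 0 < 2 * t) by lra.
  pose proof (period_sum_ge_1 _ Ht). pose proof (half_period_sum_pos _ Ht).
  pose proof (period_sum_ge_1 _ Ht2). pose proof (half_period_sum_pos _ Ht2).
  rewrite <- gauss_integral_agm by lra.
  rewrite <- (gauss_integral_scale 2) by
    (try apply sqrt_lt_R0; try apply Rmult_lt_0_compat; lra).
  do 2 f_equal.
  - rewrite (period_sum_duplication t) by assumption. field.
  - rewrite <- (sqrt_pow2 (half_period_sum t)) by lra.
    rewrite half_period_sum_duplication by assumption.
    rewrite <- (sqrt_pow2 2) at 1 by lra.
    rewrite <- sqrt_mult by nra. f_equal. ring.
Qed.

(** Halving [t] halves the integral, while both arguments approach [PI / t]. *)
Lemma gauss_integral_half_period (t : R) :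
  0 < t -> gauss_integral (period_sum t) (half_period_sum t) = t / 2.
Proof.
  intros Ht. set (J := gauss_integral (period_sum t) (half_period_sum t)).
  assert (Hn : forall n : nat,
     J = 2 ^ n * gauss_integral (period_sum (t / 2 ^ n)) (half_period_sum (t / 2 ^ n))).
  { induction n as [|n IH].
    - simpl. rewrite Rdiv_1_r. unfold J. ring.
    - assert (H2 : 0 < 2 ^ n) by (apply pow_lt; lra).
      rewrite IH. replace (t / 2 ^ n) with (2 * (t / 2 ^ S n)) by (simpl; field; lra).
      rewrite gauss_integral_half_period_step.
      + simpl. ring.
      + apply Rdiv_lt_0_compat; [exact Ht|apply pow_lt; lra]. }
  pose proof PI_RGT_0 as Hpi.
  assert (Hb : forall n : nat,
     t * PI / 2 <= J * (PI + t * (1 / 2) ^ n) /\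
     J * (PI - 2 * t * (1 / 2) ^ n) <= t * PI / 2).
  { intros n. specialize (Hn n).
    assert (H2 : 0 < 2 ^ n) by (apply pow_lt; lra).
    rewrite pow_half_inv.
    replace (2 * t * / 2 ^ n) with (2 * (t / 2 ^ n)) by (field; lra).
    change (t * / 2 ^ n) with (t / 2 ^ n).
    assert (Es : 2 ^ n * (t / 2 ^ n) = t) by (field; lra).
    set (s := t / 2 ^ n) in *.
    assert (Hs : 0 < s) by (apply Rdiv_lt_0_compat; assumption).
    pose proof (period_sum_bounds _ Hs) as A. pose proof (half_period_sum_bounds _ Hs) as B.
    pose proof (half_period_sum_pos _ Hs) as Bp. pose proof (half_period_sum_lt _ Hs) as BA.
    destruct (gauss_integral_bounds (period_sum s) (half_period_sum s) Bp) as [L U]; [lra|].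
    set (Js := gauss_integral (period_sum s) (half_period_sum s)) in *.
    assert (HJs : 0 < Js) by nra.
    assert (As : period_sum s * s <= PI + s).
    { apply Rle_trans with ((PI / s + 1) * s); [apply Rmult_le_compat_r; lra|].
      right. field. lra. }
    assert (Bs : PI - 2 * s <= half_period_sum s * s).
    { apply Rle_trans with ((PI / s - 2) * s); [right; field; lra|].
      apply Rmult_le_compat_r; lra. }
    rewrite Hn, <- Es.
    split.
    - apply Rle_trans with (2 ^ n * (Js * (period_sum s * s))).
      + replace (2 ^ n * (Js * (period_sum s * s)))
          with (2 ^ n * s * (Js * period_sum s)) by ring.
        replace (2 ^ n * s * PI / 2) with (2 ^ n * s * (PI / 2)) by field.
        apply Rmult_le_compat_l; [nra|exact L].
      + rewrite Rmult_assoc. apply Rmult_le_compat_l; [lra|].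
        apply Rmult_le_compat_l; lra.
    - apply Rle_trans with (2 ^ n * (Js * (half_period_sum s * s))).
      + rewrite Rmult_assoc. apply Rmult_le_compat_l; [lra|].
        apply Rmult_le_compat_l; lra.
      + replace (2 ^ n * (Js * (half_period_sum s * s)))
          with (2 ^ n * s * (Js * half_period_sum s)) by ring.
        replace (2 ^ n * s * PI / 2) with (2 ^ n * s * (PI / 2)) by field.
        apply Rmult_le_compat_l; [nra|exact U]. }
  apply Rmult_eq_reg_r with PI; [|lra].
  apply Rle_antisym.
  - apply le_of_geometric_error with (J * (2 * t)). intros n.
    specialize (Hb n). lra.
  - apply le_of_geometric_error with (J * t). intros n.
    specialize (Hb n). lra.
Qed.

(** * Complete elliptic integrals *)

(** Homogeneity of the integral; the hypothesis says that [c / a = k']. *)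
Lemma ellipticK_gauss (k a c : R) :
  0 < a -> 0 < c -> a ^ 2 * (1 - k ^ 2) = c ^ 2 -> ellipticK k = a * gauss_integral a c.
Proof.
  intros Ha Hc E.
  apply eq_trans with (2 := RInt_scal _ 0 (PI / 2) a (ex_RInt_gauss a c 0 (PI / 2) Ha Hc)).
  unfold ellipticK. apply RInt_ext. intros x _.
  assert (Hp : 0 < 1 - k ^ 2 * sin x ^ 2).
  { pose proof (gauss_radicand_pos a c x Ha Hc) as H. rewrite cos_sq, <- E in H.
    assert (0 < a ^ 2) by (apply pow_lt; lra). nra. }
  assert (Hs : 0 < sqrt (1 - k ^ 2 * sin x ^ 2)) by now apply sqrt_lt_R0.
  assert (Hi : gauss_integrand a c x = / (a * sqrt (1 - k ^ 2 * sin x ^ 2))).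
  { unfold gauss_integrand. f_equal. rewrite cos_sq, <- E.
    replace (a ^ 2 * (1 - sin x ^ 2) + a ^ 2 * (1 - k ^ 2) * sin x ^ 2)
      with (a ^ 2 * (1 - k ^ 2 * sin x ^ 2)) by ring.
    rewrite sqrt_mult, sqrt_pow2 by nra. reflexivity. }
  assert (Hr : 1 / sqrt (1 - k ^ 2 * sin x ^ 2) = a * gauss_integrand a c x).
  { rewrite Hi. field. lra. }
  exact Hr.
Qed.

Lemma ellipticK_radicand_pos (k x : R) : k ^ 2 < 1 -> 0 < 1 - k ^ 2 * sin x ^ 2.
Proof.
  intros Hk. pose proof (cos_sq x). pose proof (pow2_ge_0 (cos x)).
  pose proof (pow2_ge_0 (sin x)). pose proof (pow2_ge_0 k). nra.
Qed.

Lemma continuous_ellipticK_integrand (k x : R) :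
  k ^ 2 < 1 -> continuous (fun x => 1 / sqrt (1 - k ^ 2 * sin x ^ 2)) x.
Proof.
  intros Hk. pose proof (ellipticK_radicand_pos k x Hk) as Hp.
  apply (ex_derive_continuous (fun x => 1 / sqrt (1 - k ^ 2 * sin x ^ 2))).
  auto_derive. simpl in *. repeat split; [lra|].
  apply Rgt_not_eq, sqrt_lt_R0. lra.
Qed.

Lemma ellipticK_increasing (k l : R) :
  k ^ 2 < l ^ 2 -> l ^ 2 < 1 -> ellipticK k < ellipticK l.
Proof.
  intros Hkl Hl. pose proof PI_RGT_0. apply RInt_lt; [lra| | |].
  - intros x _. apply continuous_ellipticK_integrand. lra.
  - intros x _. apply continuous_ellipticK_integrand. lra.
  - intros x Hx. pose proof (ellipticK_radicand_pos l x Hl).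
    assert (Hsin : 0 < sin x) by (apply sin_gt_0; lra).
    assert (0 < sin x ^ 2) by (apply pow_lt; lra).
    unfold Rdiv. rewrite !Rmult_1_l. apply Rinv_lt_contravar.
    + apply Rmult_lt_0_compat; apply sqrt_lt_R0; nra.
    + apply sqrt_lt_1; nra.
Qed.

Lemma ellipticK_sq (k l : R) : k ^ 2 = l ^ 2 -> ellipticK k = ellipticK l.
Proof. intros H. unfold ellipticK. now rewrite H. Qed.

Lemma ellipticK_pos (k : R) : k ^ 2 < 1 -> 0 < ellipticK k.
Proof.
  intros Hk. assert (Hc : 0 < sqrt (1 - k ^ 2)) by (apply sqrt_lt_R0; lra).
  assert (Hc2 : sqrt (1 - k ^ 2) ^ 2 = 1 - k ^ 2) by (apply pow2_sqrt; lra).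
  assert (Hc1 : sqrt (1 - k ^ 2) <= 1) by (pose proof (pow2_ge_0 k); nra).
  rewrite (ellipticK_gauss k 1 (sqrt (1 - k ^ 2))) by lra.
  destruct (gauss_integral_bounds 1 _ Hc Hc1) as [L _].
  pose proof PI_RGT_0. lra.
Qed.

Lemma compl_modulus_sq (k : R) : k ^ 2 <= 1 -> compl_modulus k ^ 2 = 1 - k ^ 2.
Proof. intros Hk. unfold compl_modulus. apply pow2_sqrt. lra. Qed.

(** [K] increases and [K'] decreases with [k ^ 2]. *)
Lemma period_ratio_decreasing (k l : R) :
  0 < k ^ 2 < l ^ 2 -> l ^ 2 < 1 ->
  ellipticK' l / ellipticK l < ellipticK' k / ellipticK k.
Proof.
  intros Hk Hl.
  pose proof (ellipticK_increasing k l (proj2 Hk) Hl) as HK.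
  assert (HK' : ellipticK' l < ellipticK' k).
  { unfold ellipticK'. apply ellipticK_increasing; rewrite !compl_modulus_sq; lra. }
  assert (H0 : 0 < ellipticK k) by (apply ellipticK_pos; lra).
  assert (H1 : 0 < ellipticK' l).
  { unfold ellipticK'. apply ellipticK_pos. rewrite compl_modulus_sq; lra. }
  unfold Rdiv. apply Rmult_gt_0_lt_compat; [apply Rinv_0_lt_compat; lra|lra|lra|].
  apply Rinv_lt_contravar; [|exact HK]. apply Rmult_lt_0_compat; lra.
Qed.

Lemma period_ratio_injective (k l : R) :
  0 < k ^ 2 < 1 -> 0 < l ^ 2 < 1 ->
  ellipticK' k / ellipticK k = ellipticK' l / ellipticK l -> k ^ 2 = l ^ 2.
Proof.
  intros Hk Hl E. destruct (Rtotal_order (k ^ 2) (l ^ 2)) as [H|[H|H]]; [|exact H|].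
  - pose proof (period_ratio_decreasing k l (conj (proj1 Hk) H) (proj2 Hl)). lra.
  - pose proof (period_ratio_decreasing l k (conj (proj1 Hl) H) (proj2 Hk)). lra.
Qed.

Theorem theorem1 (k : R) (hk : 0 < k ^ 2 < 1)
  (hconv : ex_series (fun n : nat =>
     (-1) ^ n * (2 * INR n + 1) ^ 2 /
       (exp ((2 * INR n + 1) * (ellipticK' k / ellipticK k) * PI) - 1))) :
  Series (fun n : nat =>
     (-1) ^ n * (2 * INR n + 1) ^ 2 /
       (exp ((2 * INR n + 1) * (ellipticK' k / ellipticK k) * PI) - 1))
  = 1 / 4 + 2 * (k ^ 2 - 1) * ellipticK k ^ 3 / PI ^ 3.
Proof.
  clear hconv. pose proof PI_RGT_0 as Hpi.
  (* The nome of [k] is [exp (- t)]. *)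
  set (t := ellipticK' k / ellipticK k * PI).
  assert (Ht : 0 < t).
  { apply Rmult_lt_0_compat; [|exact Hpi]. apply Rdiv_lt_0_compat.
    - apply ellipticK_pos. rewrite compl_modulus_sq; lra.
    - apply ellipticK_pos. lra. }
  pose proof (period_sum_ge_1 t Ht) as Ha.
  pose proof (half_period_sum_pos t Ht) as Hb.
  pose proof (half_period_sum_lt t Ht) as Hab.
  pose proof (complementary_sum_pos t Ht) as Hc.
  pose proof (complementary_sum_sq t Ht) as Ec.
  set (a := period_sum t) in *. set (b := half_period_sum t) in *.
  set (l := b / a).
  assert (El : a ^ 2 * l ^ 2 = b ^ 2) by (unfold l; field; lra).
  assert (Hl : 0 < l ^ 2 < 1) by (split; nra).
  assert (K1 : ellipticK l = a * (PI / 2)).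
  { rewrite (ellipticK_gauss l a (complementary_sum t)) by nra.
    f_equal. now apply gauss_integral_complementary. }
  assert (K2 : ellipticK' l = a * (t / 2)).
  { unfold ellipticK'. rewrite (ellipticK_gauss _ a b); try lra.
    - f_equal. now apply gauss_integral_half_period.
    - rewrite compl_modulus_sq by lra. nra. }
  (* The ratio of the periods of [l] is [t / PI], which is that of [k]. *)
  assert (Ekl : k ^ 2 = l ^ 2).
  { apply period_ratio_injective; [exact hk|exact Hl|].
    rewrite K1, K2. unfold t.
    assert (0 < ellipticK k) by (apply ellipticK_pos; lra). field. lra. }
  rewrite (Series_ext _ (fun n => (-1) ^ n * (2 * INR n + 1) ^ 2
                                  / (exp ((2 * INR n + 1) * t) - 1))).
  2:{ intros n. unfold t. now rewrite Rmult_assoc. }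
  pose proof (lambert_series t Ht) as S.
  rewrite (sech_cube_sum t Ht) in S.
  change (sech_pow_sum 1 t 0) with a in S. change (sech_pow_sum 1 t (t / 2)) with b in S.
  rewrite (ellipticK_sq k l Ekl), K1, Ekl.
  set (s := Series _) in *.
  transitivity ((1 - a * (a ^ 2 - b ^ 2)) / 4); [lra|].
  rewrite <- El. field. lra.
Qed.
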